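(* Let $F:\mathbb{R}^n\to\mathbb{R}$ be a convex differentiable function with $X^*:=\operatorname{argmin} F\neq\emptyset$ and $F^*:=\inf F$. Let $\gamma_1>2$, $\gamma_2>2$ and $\alpha>0$, let $t_0>0$, and let $x:[t_0,+\infty)\to\mathbb{R}^n$ be a solution of $$\ddot{x}(t)+\frac{\alpha}{t}\dot{x}(t)+\nabla F(x(t))=0 .$$ Assume that $F$ is coercive and satisfies $\mathbf{H}_1(\gamma_1)$ and $\mathbf{H}_2(\gamma_2)$ with $\gamma_1\leq\gamma_2$. If $\alpha\geq\frac{\gamma_1+2}{\gamma_1-2}$, then, as $t\to+\infty$, $$F(x(t))-F^*=O\left(\frac{1}{t^{\frac{2\gamma_2}{\gamma_2-2}}}\right).$$
   Context: $\mathbb{R}^n$ carries the Euclidean scalar product $\langle\cdot,\cdot\rangle$ and norm $\|\cdot\|$; $B(x^*,r)$ is the open Euclidean ball of center $x^*$ and radius $r$; $d(x,X^* )$ is the distance from $x$ to $X^*$. Coercive means $F(x)\to+\infty$ as $\|x\|\to+\infty$. For a convex differentiable $F:\mathbb{R}^n\to\mathbb{R}$ with $X^*=\operatorname{argmin}F\neq\emptyset$ and $F^*=\inf F$: Hypothesis $\mathbf{H}_1(\gamma)$ ($\gamma\geq 1$): for any minimizer $x^*\in X^*$ there exists $\eta>0$ such that $$\forall x\in B(x^*,\eta),\quad F(x)-F^*\leq\frac{1}{\gamma}\langle\nabla F(x),x-x^*\rangle .$$ Hypothesis $\mathbf{H}_2(r)$ ($r\geq 1$): for any minimizer $x^*\in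 X^*$ there exist $K>0$ and $\varepsilon>0$ such that $$\forall x\in B(x^*,\varepsilon),\quad K\,d(x,X^* )^r\leq F(x)-F^* .$$ Standing assumption: for any initial conditions $(x_0,v_0)\in\mathbb{R}^n\times\mathbb{R}^n$, the Cauchy problem for the differential equation with $x(t_0)=x_0$, $\dot x(t_0)=v_0$ has a unique global solution on $[t_0,+\infty)$. *)

(* Defs.v *)
From mathcomp Require Import all_boot all_order all_algebra.
From mathcomp Require Import all_classical all_reals all_analysis.

Set Implicit Arguments.
Unset Strict Implicit.
Unset Printing Implicit Defensive.

Import Order.TTheory GRing.Theory Num.Theory.
Import numFieldNormedType.Exports.

Local Open Scope classical_set_scope.
Local Open Scope ring_scope.

(* The library norm `|x| on 'rV[R]_n is the sup norm, hence the Euclidean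
   structure below.  Notions that only depend on the topology (limits,
   derivatives, differentiability) use the library structure. *)
Definition dotp (R : realType) (n : nat) (u v : 'rV[R]_n) : R :=
  \sum_(i < n) u ord0 i * v ord0 i.

Definition enorm (R : realType) (n : nat) (u : 'rV[R]_n) : R :=
  Num.sqrt (dotp u u).

Definition eball (R : realType) (n : nat) (c : 'rV[R]_n) (r : R) :
  set 'rV[R]_n := [set x | enorm (x - c) < r].

Definition edist (R : realType) (n : nat) (x : 'rV[R]_n)
  (A : set 'rV[R]_n) : R := inf [set enorm (x - y) | y in A].

Definition gradient (R : realType) (n : nat) (F : 'rV[R]_n -> R)
  (x : 'rV[R]_n) : 'rV[R]_n := \row_i 'D_(delta_mx ord0 i) F x.

Definition argmin (R : realType) (n : nat) (F : 'rV[R]_n -> R) :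
  set 'rV[R]_n := [set x | forall y, F x <= F y].

(* The real-valued [inf] is 0 on sets that are empty or not bounded below; it
   is only used when [argmin F] is nonempty. *)
Definition infval (R : realType) (n : nat) (F : 'rV[R]_n -> R) : R :=
  inf (range F).

Definition coercive (R : realType) (n : nat) (F : 'rV[R]_n -> R) : Prop :=
  forall A : R, exists M : R, forall x, M <= enorm x -> A <= F x.

Definition H1 (R : realType) (n : nat) (F : 'rV[R]_n -> R) (gamma : R) : Prop :=
  forall xs, argmin F xs ->
  exists2 eta : R, 0 < eta &
    forall x, eball xs eta x ->
      F x - infval F <= 1 / gamma * dotp (gradient F x) (x - xs).

Definition H2 (R : realType) (n : nat) (F : 'rV[R]_n -> R) (r : R) : Prop :=
  forall xs, argmin F xs ->
  exists K eps : R, [/\ 0 < K, 0 < eps &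
    forall x, eball xs eps x ->
      K * edist x (argmin F) `^ r <= F x - infval F].

(* [l] is the derivative at [t] of [f] restricted to [t0, +oo[: two-sided for
   t0 < t, from the right for t = t0. *)
Definition has_deriv_from (R : realType) (n : nat) (t0 : R)
    (f : R -> 'rV[R]_n) (t : R) (l : 'rV[R]_n) : Prop :=
  h^-1 *: (f (t + h) - f t) @[h --> within [set h | t0 <= t + h] (0 : R)^'] --> l.

Definition solves_ode_with (R : realType) (n : nat) (F : 'rV[R]_n -> R)
    (alpha t0 : R) (x v : R -> 'rV[R]_n) : Prop :=
  forall t, t0 <= t ->
    has_deriv_from t0 x t (v t) /\
    exists2 a : 'rV[R]_n, has_deriv_from t0 v t a &
      a + (alpha / t) *: v t + gradient F (x t) = 0.

(* Functions on [t0, +oo[ are represented by functions on R whose values to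
   the left of [t0] are irrelevant. *)
Definition solves_ode (R : realType) (n : nat) (F : 'rV[R]_n -> R)
    (alpha t0 : R) (x : R -> 'rV[R]_n) : Prop :=
  exists v, solves_ode_with F alpha t0 x v.

Definition solves_cauchy (R : realType) (n : nat) (F : 'rV[R]_n -> R)
    (alpha t0 : R) (x0 v0 : 'rV[R]_n) (x : R -> 'rV[R]_n) : Prop :=
  exists v, [/\ solves_ode_with F alpha t0 x v, x t0 = x0 & v t0 = v0].

Definition well_posed (R : realType) (n : nat) (F : 'rV[R]_n -> R)
    (alpha t0 : R) : Prop :=
  forall x0 v0 : 'rV[R]_n, exists2 x, solves_cauchy F alpha t0 x0 v0 x &
    forall y, solves_cauchy F alpha t0 x0 v0 y ->
      forall t, t0 <= t -> y t = x t.

(* Lets [f =O_+oo g] elaborate; the library has no such instance. *)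
Canonical pinfty_filter_on (R : numFieldType) :=
  FilterType (pinfty_nbhs R) _.

(* Main.v *)
Require Import Defs.
From mathcomp Require Import all_boot all_order all_algebra.
From mathcomp Require Import all_classical all_reals all_analysis.
From mathcomp Require Import ring lra.

Set Implicit Arguments.
Unset Strict Implicit.
Unset Printing Implicit Defensive.

Import Order.TTheory GRing.Theory Num.Theory.
Import numFieldNormedType.Exports.

Local Open Scope classical_set_scope.
Local Open Scope ring_scope.

(** Flatness with the exponent [gamma1] implies flatness with any smaller one, so
    the damping may be taken critical: with [lam := (alpha - 1) / 2] the exponent
    is [gamma := 2 (lam + 1) / lam].  Let [e := F(x) - inf F + |v|^2 / 2] be the
    energy, and for a minimizer [c] let
    [S_c := t^(2 lam) (t^2 e + lam t <x - c, v>)].  The identity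
    [S_c' = lam t^(2 lam + 1) (gamma (F(x) - inf F) - <grad F(x), x - c>)] shows
    that [S_c] is nonincreasing while [x] is in the ball where flatness at [c]
    holds ([potential_nonincreasing]).  A bound on [S_c] bounds [F(x) - inf F] by
    a multiple of [|x - c|^2 / t^2], up to [t^(- 2 lam - 2)]; so the theorem
    amounts to [|x - c| = O(t^(- kap))] with [kap := 2 / (gamma2 - 2) <= lam].

    Two points make this more than a computation when there are many minimizers:
    the radius of flatness is not uniform in [c], so that a centre close to the
    trajectory has to be available; and the growth hypothesis controls the
    distance to the set of minimizers, not the distance to [c].

    For the first point the trajectory is shown to converge.  A soft average of
    finitely many minimizers serves as a moving centre.  It is the gradient of a
    convex function of the position, hence moves monotonically with it, and this
    motion only helps in the Lyapunov estimate ([derive_soft_radial_le]); the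
    average sees flatness with half the exponent, which gives [t^2 e -> 0]
    ([sqr_time_energy_vanishes_of_H1]).  Then [S_c] for a cluster point [c] traps
    the trajectory near [c] ([flow_converges]).

    For the second point let [c] be the limit.  For every other minimizer [d] the
    product [<x - c, d - c>] is of second order ([tangential_drift]), because the
    force [- grad F] never pushes away from [d].  Finitely many directions represent all
    those of the minimizers seen from [c] ([dotp_bound_near_vertex]), so [x - c]
    is almost orthogonal to the set of minimizers and [|x - c|] is comparable to
    the distance to that set.  At a time where [t^kap |x - c|] is large, growth
    and the bound on [S_c] then force it to decrease ([distance_rate]). *)

(** * The Euclidean norm on row vectors *)

Section Euclidean.
Context {R : realType} {n : nat}.
Implicit Types (u v w x y z c : 'rV[R]_n) (a r : R).

Lemma dotpC u v : dotp u v = dotp v u.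
Proof. by apply: eq_bigr => i _; rewrite mulrC. Qed.

Lemma dotpDl u v w : dotp (u + v) w = dotp u w + dotp v w.
Proof. by rewrite -big_split; apply: eq_bigr => i _; rewrite mxE mulrDl. Qed.

Lemma dotpZl a u w : dotp (a *: u) w = a * dotp u w.
Proof. by rewrite mulr_sumr; apply: eq_bigr => i _; rewrite mxE mulrA. Qed.

Lemma dotpNl u w : dotp (- u) w = - dotp u w.
Proof. by rewrite -scaleN1r dotpZl mulN1r. Qed.

Lemma dotpBl u v w : dotp (u - v) w = dotp u w - dotp v w.
Proof. by rewrite dotpDl dotpNl. Qed.

Lemma dotpDr u v w : dotp w (u + v) = dotp w u + dotp w v.
Proof. by rewrite !(dotpC w) dotpDl. Qed.

Lemma dotpBr u v w : dotp w (u - v) = dotp w u - dotp w v.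
Proof. by rewrite !(dotpC w) dotpBl. Qed.

Lemma dotpNr u w : dotp w (- u) = - dotp w u.
Proof. by rewrite !(dotpC w) dotpNl. Qed.

Lemma dotpZr a u w : dotp w (a *: u) = a * dotp w u.
Proof. by rewrite !(dotpC w) dotpZl. Qed.

Lemma dotp_ge0 u : 0 <= dotp u u.
Proof. by apply: sumr_ge0 => i _; rewrite -expr2 sqr_ge0. Qed.

Lemma dotp0l u : dotp 0 u = 0.
Proof. by rewrite -(scale0r 0) dotpZl mul0r. Qed.

Lemma dotp0r u : dotp u 0 = 0.
Proof. by rewrite dotpC dotp0l. Qed.

Lemma enorm0 : enorm (0 : 'rV[R]_n) = 0.
Proof. by rewrite /enorm dotp0l sqrtr0. Qed.

Lemma enorm_ge0 u : 0 <= enorm u.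
Proof. exact: sqrtr_ge0. Qed.

Lemma enorm_sqr u : enorm u ^+ 2 = dotp u u.
Proof. by rewrite sqr_sqrtr// dotp_ge0. Qed.

Lemma ler_enorm u a : 0 <= a -> (enorm u <= a) = (dotp u u <= a ^+ 2).
Proof. by move=> a0; rewrite -enorm_sqr ler_pXn2r// nnegrE enorm_ge0. Qed.

Lemma ltr_enorm u a : 0 <= a -> (enorm u < a) = (dotp u u < a ^+ 2).
Proof. by move=> a0; rewrite -enorm_sqr ltr_pXn2r// nnegrE enorm_ge0. Qed.

Lemma coord_le_enorm u i : `|u ord0 i| <= enorm u.
Proof.
rewrite -sqrtr_sqr ler_wsqrtr// /dotp (bigD1 i)//= -expr2 lerDl.
by apply: sumr_ge0 => j _; rewrite -expr2 sqr_ge0.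
Qed.

Lemma enorm_eq0 u : enorm u = 0 -> u = 0.
Proof.
move=> u0; apply/rowP => i; rewrite mxE; apply/eqP; rewrite -normr_eq0.
by rewrite eq_le normr_ge0 andbT -u0 coord_le_enorm.
Qed.

Lemma dotp_le_enorm u v : dotp u v <= enorm u * enorm v.
Proof.
have [/enorm_eq0 ->|u0] := eqVneq (enorm u) 0.
  by rewrite dotp0l enorm0 mul0r.
have [/enorm_eq0 ->|v0] := eqVneq (enorm v) 0.
  by rewrite dotp0r enorm0 mulr0.
have up : 0 < enorm u by rewrite lt_neqAle eq_sym u0 enorm_ge0.
have vp : 0 < enorm v by rewrite lt_neqAle eq_sym v0 enorm_ge0.
have := dotp_ge0 (enorm v *: u - enorm u *: v).
rewrite dotpBl !dotpBr !dotpZl !dotpZr (dotpC v u) -!enorm_sqr => H.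
(* [H] reads [0 <= 2 p (p - <u, v>)] with [p := |u| |v|] *)
rewrite -(ler_pM2l (mulr_gt0 up vp)); nra.
Qed.

Lemma normr_dotp_le u v : `|dotp u v| <= enorm u * enorm v.
Proof.
rewrite ler_norml dotp_le_enorm andbT lerNl -dotpNl.
by apply: le_trans (dotp_le_enorm _ _) _; rewrite /enorm dotpNl dotpNr opprK.
Qed.

Lemma enormN u : enorm (- u) = enorm u.
Proof. by rewrite /enorm dotpNl dotpNr opprK. Qed.

Lemma enormZ a u : enorm (a *: u) = `|a| * enorm u.
Proof.
by rewrite /enorm dotpZl dotpZr mulrA -expr2 sqrtrM ?sqr_ge0// sqrtr_sqr.
Qed.

Lemma enormD u v : enorm (u + v) <= enorm u + enorm v.
Proof.
rewrite ler_enorm ?addr_ge0 ?enorm_ge0// dotpDl !dotpDr (dotpC v u).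
by rewrite -!enorm_sqr; have := dotp_le_enorm u v; nra.
Qed.

Lemma enorm_distC u v : enorm (u - v) = enorm (v - u).
Proof. by rewrite -opprB enormN. Qed.

Lemma enorm_triangle z u v : enorm (u - v) <= enorm (u - z) + enorm (z - v).
Proof. by rewrite -[u - v](subrKA z) enormD. Qed.

Lemma enorm_continuous c : continuous (fun x => enorm (x - c)).
Proof.
move=> x; apply: (@continuous_comp _ _ _ (fun x => dotp (x - c) (x - c))).
  apply: (@cvg_big _ _ _ _ _ _ _ (nbhs x)) => [|i _]; first exact: add_continuous.
  have ci : {for x, continuous (fun x => (x - c) ord0 i)}.
    apply: (@continuous_comp _ _ _ (fun y => y - c) (fun y => y ord0 i)).
      by apply: continuousB; [exact: cvg_id|exact: cst_continuous].
    exact: coord_continuous.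
  exact: cvgM.
exact: sqrt_continuous.
Qed.

Lemma closed_enorm_preimage (S : set R) :
  closed S -> closed [set x : 'rV[R]_n | S (enorm x)].
Proof.
move=> cS; rewrite (_ : [set x | _] = (fun x => enorm (x - 0)) @^-1` S).
  by apply: closed_comp => // y _; exact: enorm_continuous.
by apply/seteqP; split => x /=; rewrite subr0.
Qed.

Lemma open_eball c r : open (eball c r).
Proof.
rewrite (_ : eball c r = (fun x => enorm (x - c)) @^-1` [set a | a < r]) //.
by apply: open_comp; [move=> x _; exact: enorm_continuous|exact: open_lt].
Qed.

Lemma compact_of_enorm_bounded (A : set 'rV[R]_n) a :
  closed A -> (forall x, A x -> enorm x <= a) -> compact A.
Proof.
move=> cA Aa.
(* the sup-norm box that contains the Euclidean ball *)
have Kc : compact [set x : 'rV[R]_n | forall i, x ord0 i \in `[(- a), a]].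
  apply: (@rV_compact _ _ (fun=> `[(- a), a]%classic)) => _.
  exact: segment_compact.
apply: subclosed_compact cA Kc _ => x /Aa xa i.
by rewrite /= in_itv /= -ler_norml (le_trans (coord_le_enorm _ _)).
Qed.

(** The radius may depend on the centre, with no lower bound: this is how the
    local hypotheses at the minimizers become finitely many. *)
Lemma finite_eball_cover (A : set 'rV[R]_n) (rad : 'rV[R]_n -> R) :
  compact A -> (forall z, A z -> 0 < rad z) ->
  exists2 s : seq 'rV[R]_n, (forall z, z \in s -> A z) &
    forall y, A y -> exists2 z, z \in s & enorm (y - z) < rad z.
Proof.
rewrite compact_cover => cA rad0.
have [||D DA Dcov] := cA _ A (fun z => eball z (rad z)).
- by move=> z _; exact: open_eball.
- by move=> y Ay; exists y => //=; rewrite /eball /= subrr enorm0 rad0.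
exists (finmap.enum_fset D) => [z zD|y /Dcov[z /= zD yz]].
  by have := DA z zD; rewrite inE.
by exists z.
Qed.

End Euclidean.

(** * Derivatives and bounds along the real line *)

Section Calculus.
Context {R : realType}.
Implicit Types (f g : R -> R) (s t a b m : R).

(** The differentiation rules in this section are about functions given
    pointwise, to match the syntax of concrete formulas (see [derive_step]). *)
Lemma derive_cst_fun t a : is_derive t 1 (fun _ : R => a) (0 : R).
Proof. exact: is_derive_cst. Qed.

Lemma derive_id_fun t : is_derive t 1 (fun s : R => s) (1 : R).
Proof. exact: is_derive_id. Qed.

Lemma derive_add_fun f g t a b : is_derive t 1 f a -> is_derive t 1 g b ->
  is_derive t 1 (fun s => f s + g s) (a + b).
Proof. by move=> df dg; exact: is_deriveD. Qed.

Lemma derive_sub_fun f g t a b : is_derive t 1 f a -> is_derive t 1 g b ->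
  is_derive t 1 (fun s => f s - g s) (a - b).
Proof. by move=> df dg; exact: is_deriveB. Qed.

Lemma derive_mul_fun f g t a b : is_derive t 1 f a -> is_derive t 1 g b ->
  is_derive t 1 (fun s => f s * g s) (a * g t + f t * b).
Proof.
move=> df dg; apply: (is_derive_eq (is_deriveM df dg)).
by rewrite addrC [g t *: a]mulrC.
Qed.

Lemma derive_comp_fun f g t a b :
  is_derive (g t) 1 f a -> is_derive t 1 g b ->
  is_derive t 1 (fun s => f (g s)) (a * b).
Proof. by move=> df dg; exact: (is_derive1_comp df dg). Qed.

Lemma derive_sqr_fun f t a : is_derive t 1 f a ->
  is_derive t 1 (fun s => f s ^+ 2) (2 * f t * a).
Proof.
move=> df; rewrite (_ : (fun _ => _) = (fun s => f s * f s)); last first.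
  by apply/funext => s; rewrite expr2.
by apply: (is_derive_eq (derive_mul_fun df df)); ring.
Qed.

Lemma derive_exp_fun f t a : is_derive t 1 f a ->
  is_derive t 1 (fun s => expR (f s)) (expR (f t) * a).
Proof. by move=> df; apply: derive_comp_fun df; exact: is_derive_expR. Qed.

Lemma derive_ln_fun f t a : 0 < f t -> is_derive t 1 f a ->
  is_derive t 1 (fun s => ln (f s)) (a / f t).
Proof.
move=> f0 df; rewrite mulrC; apply: derive_comp_fun df.
exact: is_derive1_ln.
Qed.

Lemma derive_inv_fun t : 0 < t -> is_derive t 1 (fun s : R => s^-1) (- (t ^+ 2)^-1).
Proof.
move=> t0; have df : is_derive t 1 (fun s : R => s) (1 : R) by exact: is_derive_id.
have tn0 : (fun s : R => s) t != 0 by rewrite gt_eqF.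
have [dt _] := df; split; first exact: (derivableV tn0 dt).
by rewrite (deriveV tn0 dt) derive_val [LHS]mulr1.
Qed.

Lemma derive_invf_fun f t a : 0 < f t -> is_derive t 1 f a ->
  is_derive t 1 (fun s => (f s)^-1) (- (f t ^+ 2)^-1 * a).
Proof.
move=> f0 df; apply: (@derive_comp_fun (fun y : R => y^-1) f) df.
exact: derive_inv_fun.
Qed.

Lemma derive_powR_fun t a : 0 < t -> is_derive t 1 (fun s => s `^ a) (a * (t `^ a / t)).
Proof.
move=> t0; apply: (is_derive_eq (is_derive1_powR a t0)).
by rewrite powRB ?(gt_eqF t0) ?implybT// powRr1 ?ltW.
Qed.

Lemma derive_sum_fun (I : Type) (r : seq I) (f : I -> R -> R) (a : I -> R) t :
  (forall i, is_derive t 1 (f i) (a i)) ->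
  is_derive t 1 (fun s => \sum_(i <- r) f i s) (\sum_(i <- r) a i).
Proof.
move=> df; elim: r => [|i r IH].
  rewrite big_nil (_ : (fun _ => _) = (fun=> 0)); first exact: derive_cst_fun.
  by apply/funext => s; rewrite big_nil.
rewrite big_cons (_ : (fun _ => _) = (fun s => f i s + \sum_(j <- r) f j s)).
  exact: derive_add_fun.
by apply/funext => s; rewrite big_cons.
Qed.

Lemma continuous_of_derive f t a : is_derive t 1 f a -> {for t, continuous f}.
Proof. by case=> df _; exact/differentiable_continuous/derivable1_diffP. Qed.

Lemma ler_of_derive_le0 f a b : a <= b ->
  (forall s, a <= s <= b -> exists2 d, is_derive s 1 f d & d <= 0) -> f b <= f a.
Proof.
move=> ab df.
have der s : s \in `]a, b[ -> derivable f s 1 /\ f^`()%classic s <= 0.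
  rewrite in_itv /= => /andP[/ltW sa /ltW sb].
  have [|d [fs dd] d0] := df s; first by rewrite sa sb.
  by rewrite derive1E dd.
have cf : {within `[a, b], continuous f}.
  apply: derivable_within_continuous => s; rewrite in_itv /= => /df[d [fs _] _].
  exact: fs.
have mono := ler0_derive1_le_cc (fun s h => (der s h).1) (fun s h => (der s h).2) cf.
by apply: mono; rewrite ?in_itv /= ?lexx ?ab.
Qed.

(** At the right end of an interval where it is largest, a function cannot have
    a negative slope: only its left difference quotients are used. *)
Lemma derive_ge0_of_max f a t d : a < t -> is_derive t 1 f d ->
  (forall s, a <= s <= t -> f s <= f t) -> 0 <= d.
Proof.
move=> at_ [df fd] fmax; rewrite leNgt; apply/negP => d0.
have := df; rewrite /derivable => /cvg_ex[l hl].
have dl : d = l by rewrite -fd; exact: cvg_lim hl.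
have hl' : h^-1 *: ((f \o shift t) (h *: 1) - f t) @[h --> (0 : R)^'-] --> d.
  by rewrite dl; exact: cvg_dnbhs_at_left.
suff : 0 <= d by rewrite leNgt d0.
apply: (closed_cvg _ (@closed_ge R 0) _ _ hl').
have ta0 : a - t < 0 by rewrite subr_lt0.
near=> h.
have h0 : h < 0 by near: h; exact: nbhs_left_lt.
have ha : a - t <= h by near: h; exact: nbhs_left_ge.
rewrite /= (_ : h%:A = h); last exact: mulr1.
rewrite [X in 0 <= X](_ : _ = h^-1 * (f (h + t) - f t))//.
by apply: mulr_le0; rewrite ?invr_le0 ?(ltW h0)// subr_le0 fmax//; apply/andP; split; lra.
Unshelve. all: by end_near. Qed.

(** Continuous induction: the set of times up to which the bound holds is
    closed because the bound is preserved by limits, and it is open because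
    the weak bound improves itself to a strict one. *)
Lemma continuous_bootstrap f a m :
  (forall s, a <= s -> {for s, continuous f}) ->
  f a < m ->
  (forall t, a <= t -> (forall s, a <= s <= t -> f s <= m) -> f t < m) ->
  forall t, a <= t -> f t < m.
Proof.
move=> cf fam step T aT; rewrite ltNge; apply/negP => fT.
pose B := [set s | a <= s <= T /\ m <= f s].
have B0 : B !=set0 by exists T; rewrite /B /= aT lexx.
have lbB : has_inf B by split=> //; exists a => s [/andP[]].
have aB : a <= inf B by apply: lb_le_inf => // s [/andP[]].
have BT : inf B <= T by apply: ge_inf; [case: lbB|rewrite /B /= aT lexx].
have below s : a <= s -> s < inf B -> f s < m.
  move=> as_ sB; rewrite ltNge; apply/negP => ms.
  suff : inf B <= s by rewrite leNgt sB.
  by apply: ge_inf; [case: lbB|rewrite /B /= as_ ms (le_trans (ltW sB) BT)].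
have fB : f (inf B) <= m.
  have [eB|neB] := eqVneq a (inf B); first by rewrite -eB ltW.
  have aB' : a < inf B by rewrite lt_neqAle neB.
  have := cf _ aB => /cvg_at_left_filter cl.
  apply: (closed_cvg _ (@closed_le R m) _ _ cl).
  near=> s; apply/ltW/below; last by near: s; exact: nbhs_left_lt.
  by near: s; exact: nbhs_left_ge.
have fltB : f (inf B) < m.
  apply: step => // s /andP[as_]; rewrite le_eqVlt => /predU1P[->//|sB].
  exact/ltW/below.
have nearB := cvgr_lt (f (inf B)) (cf _ aB) m fltB.
have /nbhs_ballP [e /= e0 He] : nbhs (inf B) [set s | f s < m] by exact: nearB.
have [s [/andP[as_ sT] ms] sB] := inf_adherent e0 lbB.
have sge : inf B <= s by apply: ge_inf; [case: lbB|rewrite /B /= as_ sT].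
have : f s < m.
  by apply: He; rewrite /ball /= distrC ger0_norm ?subr_ge0// ltrBlDl.
by rewrite ltNge ms.
Unshelve. all: by end_near. Qed.

End Calculus.

(** * Convex functions and smooth solutions *)

Section ConvexGradient.
Context {R : realType} {n : nat}.
Implicit Types (F : 'rV[R]_n -> R) (x y c u : 'rV[R]_n).

Lemma diff_dotp F x u : differentiable F x -> 'd F x u = dotp (gradient F x) u.
Proof.
move=> dF; rewrite {1}(row_sum_delta u) linear_sum; apply: eq_bigr => i _.
by rewrite linearZ /= mxE -deriveE// mulrC.
Qed.

(** The slope at [0] from the right of [F] on the segment from [x] to [c] is at
    most the slope of the chord. *)
Lemma convex_gradient_ge F x c : convex_function setT F -> differentiable F x ->
  F x - F c <= dotp (gradient F x) (x - c).
Proof.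
move=> cF dF; rewrite -lerN2 -dotpNr !opprB -diff_dotp// -deriveE//.
have : derivable F x (c - x) by exact: diff_derivable.
move=> /cvg_ex[l hl].
rewrite /derive (cvg_lim _ hl)//.
have {}hl := cvg_dnbhs_at_right hl.
apply: (closed_cvg _ (@closed_le R (F c - F x)) _ _ hl).
near=> h.
have h0 : 0 < h by near: h; exact: nbhs_right_gt.
have h1 : h <= 1 by near: h; apply: nbhs_right_le; exact: ltr01.
rewrite /= [X in X <= _](_ : _ = h^-1 * (F (h *: (c - x) + x) - F x))//.
rewrite ler_pdivrMl//.
have := cF (Itv01 (ltW h0) h1) c x (in_setT _) (in_setT _).
rewrite convRE /= /unstable.onem.
have -> : (conv (Itv01 (ltW h0) h1) (c : convex_lmodType _) x) = h *: (c - x) + x.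
  by rewrite /conv /= /unstable.onem scalerBl scale1r scalerBr addrA addrAC.
by lra.
Unshelve. all: by end_near. Qed.

Lemma infval_argmin F x : argmin F x -> infval F = F x.
Proof.
move=> Fx; apply/eqP; rewrite eq_le; apply/andP; split.
  apply: ge_inf; last by exists x.
  by exists (F x) => _ [y _ <-].
by apply: lb_le_inf => [|_ [y _ <-] //]; exists (F x); exists x.
Qed.

End ConvexGradient.

Section Trajectory.
Context {R : realType} {n : nat}.
Implicit Types (F : 'rV[R]_n -> R) (x v : R -> 'rV[R]_n) (c : 'rV[R]_n).

(** Coordinatewise, because scalar derivatives are all that is used later. *)
Definition curve_derive (t : R) (f : R -> 'rV[R]_n) (l : 'rV[R]_n) :=
  forall i, is_derive t 1 (fun s => f s ord0 i) (l ord0 i).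

(** A solution seen from a positive time on at which its derivatives are
    two-sided; restarting it later preserves the structure, which allows
    eventual properties to be used as if they held from the start. *)
Record damped_flow F (alpha t1 : R) x v : Prop := DampedFlow {
  flow_start_gt0 : 0 < t1;
  flow_velocity : forall t, t1 <= t -> curve_derive t x (v t);
  flow_acceleration : forall t, t1 <= t ->
    curve_derive t v (- ((alpha / t) *: v t) - gradient F (x t));
  flow_value : forall t, t1 <= t ->
    is_derive t 1 (fun s => F (x s)) (dotp (gradient F (x t)) (v t)) }.

Lemma damped_flowW F alpha t1 t2 x v : t1 <= t2 ->
  damped_flow F alpha t1 x v -> damped_flow F alpha t2 x v.
Proof.
move=> t12 [t10 dx dv dF]; split; first exact: lt_le_trans t12.
- by move=> t /(le_trans t12); exact: dx.
- by move=> t /(le_trans t12); exact: dv.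
- by move=> t /(le_trans t12); exact: dF.
Qed.

Lemma derive_dotp_fun (f g : R -> 'rV[R]_n) a b t :
  curve_derive t f a -> curve_derive t g b ->
  is_derive t 1 (fun s => dotp (f s) (g s)) (dotp a (g t) + dotp (f t) b).
Proof.
move=> df dg; rewrite /dotp -big_split; apply: derive_sum_fun => i.
exact: derive_mul_fun.
Qed.

Lemma curve_derive_subl t (f : R -> 'rV[R]_n) l c : curve_derive t f l ->
  curve_derive t (fun s => f s - c) l.
Proof.
move=> df i.
rewrite (_ : (fun _ => _) = (fun s => f s ord0 i - c ord0 i)); last first.
  by apply/funext => s; rewrite !mxE.
rewrite -[l ord0 i]subr0; apply: derive_sub_fun => //; exact: derive_cst_fun.
Qed.

Lemma curve_derive_cst t c : curve_derive t (fun=> c) 0.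
Proof. by move=> i; rewrite mxE; exact: derive_cst_fun. Qed.

(** Past [t0] the constraint [t0 <= t + h] holds for all small [h]. *)
Lemma is_derive_of_has_deriv_from (t0 t : R) (f : R -> 'rV[R]_n) l : t0 < t ->
  has_deriv_from t0 f t l -> is_derive t 1 f l.
Proof.
move=> t0t fl.
have fl' : h^-1 *: ((f \o shift t) (h *: 1) - f t) @[h --> (0 : R)^'] --> l.
  have near0 : \forall h \near (0 : R)^', t0 <= t + h.
    apply: nbhs_dnbhs; apply/nbhs_ballP; exists (t - t0); rewrite /= ?subr_gt0//.
    by move=> h; rewrite /ball /= sub0r normrN ltr_norml => /andP[? _]; lra.
  have -> : (fun h : R => h^-1 *: ((f \o shift t) (h *: 1) - f t)) =
            (fun h => h^-1 *: (f (t + h) - f t)).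
    apply/funext => h; rewrite /= (addrC t); congr (_ *: (f (_ + _) - _)).
    exact: mulr1.
  move=> P /fl H.
  by move: near0 H; apply: filterS2 => h t0h /(_ t0h).
split; first by apply/cvg_ex; exists l.
exact: cvg_lim fl'.
Qed.

Lemma curve_derive_of_is_derive (t : R) (f : R -> 'rV[R]_n) l :
  is_derive t 1 f l -> curve_derive t f l.
Proof.
move=> [df fl] i; have /derivable_mxP dfi := df; split; first exact: dfi.
by rewrite -fl derive_mx// mxE.
Qed.

Lemma damped_flow_of_solves_ode F alpha t0 t1 x :
  (forall y, differentiable F y) -> 0 < t0 -> t0 < t1 ->
  solves_ode F alpha t0 x -> exists v, damped_flow F alpha t1 x v.
Proof.
move=> dF t00 t01 [v xv]; exists v.
have dx t : t1 <= t -> is_derive t 1 x (v t).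
  move=> t1t; have t0t := lt_le_trans t01 t1t.
  exact: is_derive_of_has_deriv_from t0t (xv t (ltW t0t)).1.
split; first exact: lt_trans t01.
- by move=> t /dx; exact: curve_derive_of_is_derive.
- move=> t t1t; have t0t := lt_le_trans t01 t1t.
  have [_ [a va]] := xv t (ltW t0t).
  rewrite -addrA => /eqP; rewrite addr_eq0 opprD => /eqP <-.
  exact/curve_derive_of_is_derive/(is_derive_of_has_deriv_from t0t va).
- move=> t /dx[xd xv'].
  have xdf : differentiable x t by exact/derivable1_diffP.
  have Fxd : differentiable (F \o x) t by exact: differentiable_comp.
  split; first exact/derivable1_diffP.
  rewrite -diff_dotp// -xv' !deriveE//.
  by rewrite [in LHS](_ : (fun s => F (x s)) = F \o x)// diff_comp.
Qed.

End Trajectory.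

(** * Energies and their derivatives *)

(** Differentiates along the syntax of a formula, preferring the derivatives
    that are in the context. *)
Ltac derive_step :=
  match goal with
  | H : is_derive ?t _ ?f _ |- is_derive ?t _ ?f _ => exact: H
  | |- is_derive _ _ (fun _ => ?a) _ => exact: derive_cst_fun
  | |- is_derive _ _ (fun s => s) _ => exact: derive_id_fun
  | |- is_derive _ _ (fun s => @?f s + - (@?g s)) _ =>
      eapply (@derive_sub_fun _ f g)
  | |- is_derive _ _ (fun s => @?f s + @?g s) _ => eapply (@derive_add_fun _ f g)
  | |- is_derive _ _ (fun s => @?f s * @?g s) _ => eapply (@derive_mul_fun _ f g)
  | |- is_derive _ _ (fun s => @?f s ^+ 2) _ => eapply (@derive_sqr_fun _ f)
  | |- is_derive _ _ (fun s => s ^-1) _ => apply: derive_inv_fun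
  | |- is_derive _ _ (fun s => (@?f s)^-1) _ => eapply (@derive_invf_fun _ f)
  | |- is_derive _ _ (fun s => s `^ ?a) _ => apply: derive_powR_fun
  | |- is_derive _ _ (fun s => expR (@?f s)) _ => eapply (@derive_exp_fun _ f)
  | |- is_derive _ _ (fun s => ln (@?f s)) _ => eapply (@derive_ln_fun _ f)
  end.

Section Energies.
Context {R : realType} {n : nat} (F : 'rV[R]_n -> R) (x v : R -> 'rV[R]_n).
Implicit Types (s t : R) (c : 'rV[R]_n).

Definition gap t := F (x t) - infval F.
Definition energy t := gap t + dotp (v t) (v t) / 2.
Definition half_sqdist c t := dotp (x t - c) (x t - c) / 2.
Definition radial c t := dotp (x t - c) (v t).
Definition work c t := dotp (gradient F (x t)) (x t - c).

Variables (alpha t1 : R).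
Hypothesis flow : damped_flow F alpha t1 x v.

Lemma derive_gap t : t1 <= t ->
  is_derive t 1 gap (dotp (gradient F (x t)) (v t)).
Proof.
move=> /(flow_value flow) dF; rewrite /gap.
by eapply is_derive_eq; [repeat derive_step|rewrite subr0].
Qed.

Lemma derive_energy t : t1 <= t ->
  is_derive t 1 energy (- (alpha / t) * dotp (v t) (v t)).
Proof.
move=> t1t; have dg := derive_gap t1t.
have dv := flow_acceleration flow t1t.
have dvv := derive_dotp_fun dv dv.
rewrite /energy; eapply is_derive_eq; first by repeat derive_step.
rewrite !dotpBl !dotpBr !dotpNl !dotpNr !dotpZl !dotpZr.
rewrite (dotpC (v t) (gradient _ _)).
have : t != 0 by rewrite gt_eqF// (lt_le_trans (flow_start_gt0 flow)).
by move=> t0; field.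
Qed.

Lemma derive_half_sqdist c t : t1 <= t ->
  is_derive t 1 (half_sqdist c) (radial c t).
Proof.
move=> t1t; have dx := curve_derive_subl c (flow_velocity flow t1t).
have dxx := derive_dotp_fun dx dx.
rewrite /half_sqdist; eapply is_derive_eq; first by repeat derive_step.
by rewrite /radial (dotpC (v t)); field.
Qed.

Lemma derive_radial c t : t1 <= t ->
  is_derive t 1 (radial c)
    (dotp (v t) (v t) - alpha / t * radial c t - work c t).
Proof.
move=> t1t; have dx := curve_derive_subl c (flow_velocity flow t1t).
have dxv := derive_dotp_fun dx (flow_acceleration flow t1t).
rewrite /radial; eapply is_derive_eq; first by repeat derive_step.
by rewrite /work (dotpC (gradient _ _)) dotpBr dotpNr dotpZr; ring.
Qed.

End Energies.

(** * The energy tends to zero *)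

Lemma coercive_sublevel_bounded (R : realType) n (F : 'rV[R]_n -> R) (a : R) :
  coercive F -> exists D, forall y, F y <= a -> enorm y <= D.
Proof.
move=> /(_ (a + 1))[D HD]; exists D => y Fy; rewrite leNgt; apply/negP => Dy.
by have := HD y (ltW Dy); lra.
Qed.

Section EnergyDecay.
Context {R : realType} {n : nat} (F : 'rV[R]_n -> R) (x v : R -> 'rV[R]_n).
Variables (alpha t1 : R).
Hypothesis F_convex : convex_function setT F.
Hypothesis F_differentiable : forall y, differentiable F y.
Hypothesis argmin_nonempty : argmin F !=set0.
Hypothesis alpha_gt0 : 0 < alpha.
Hypothesis flow : damped_flow F alpha t1 x v.
Implicit Types (s t : R) (c : 'rV[R]_n).

Let t1_gt0 : 0 < t1 := flow_start_gt0 flow.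

Lemma gap_ge0 t : 0 <= gap F x t.
Proof.
by have [c Fc] := argmin_nonempty; rewrite /gap (infval_argmin Fc) subr_ge0.
Qed.

Lemma energy_ge0 t : 0 <= energy F x v t.
Proof. by rewrite addr_ge0 ?gap_ge0// divr_ge0 ?dotp_ge0. Qed.

Lemma gap_le_energy t : gap F x t <= energy F x v t.
Proof. by rewrite lerDl divr_ge0 ?dotp_ge0. Qed.

Lemma sqr_speed_le_energy t : dotp (v t) (v t) <= 2 * energy F x v t.
Proof. by have := gap_ge0 t; rewrite /energy; lra. Qed.

Lemma gap_le_work c t : argmin F c -> gap F x t <= work F x c t.
Proof. by move=> Fc; rewrite /gap (infval_argmin Fc) convex_gradient_ge. Qed.

(** Friction is the only dissipation: [e' = - (alpha / t) |v|^2]. *)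
Lemma energy_nonincreasing s t : t1 <= s -> s <= t ->
  energy F x v t <= energy F x v s.
Proof.
move=> t1s st; apply: ler_of_derive_le0 => // r /andP[sr _].
have t1r := le_trans t1s sr; have r0 := lt_le_trans t1_gt0 t1r.
exists (- (alpha / r) * dotp (v r) (v r)); first exact: (derive_energy flow t1r).
by rewrite mulNr oppr_le0 mulr_ge0 ?dotp_ge0// divr_ge0 ?ltW.
Qed.

Lemma flow_bounded : coercive F ->
  exists2 D, 0 <= D & forall t, t1 <= t -> enorm (x t) <= D.
Proof.
move=> /(coercive_sublevel_bounded (infval F + energy F x v t1))[D HD].
have xD t : t1 <= t -> enorm (x t) <= D.
  move=> t1t; apply: HD; rewrite -lerBlDl.
  exact: le_trans (gap_le_energy t) (energy_nonincreasing (lexx _) t1t).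
by exists D => //; exact: le_trans (enorm_ge0 _) (xD t1 (lexx _)).
Qed.

Lemma radial_bounded c D : 0 <= D -> (forall t, t1 <= t -> enorm (x t) <= D) ->
  forall t, t1 <= t -> `|radial x v c t| <= (D + enorm c) * enorm (v t).
Proof.
move=> D0 xD t t1t; apply: le_trans (normr_dotp_le _ _) _.
rewrite ler_wpM2r ?enorm_ge0// (le_trans (enormD _ _))// enormN lerD2r.
exact: xD.
Qed.

(** The weight [1 / t] makes this work for every positive damping: along the
    auxiliary function below the energy is integrable against [dt / t], and a
    nonincreasing function with that property tends to [0]. *)
Lemma energy_vanishes : coercive F -> forall eps, 0 < eps ->
  \forall t \near +oo, energy F x v t < eps.
Proof.
move=> /flow_bounded[D D0 xD] eps eps0.
have [c Fc] := argmin_nonempty.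
(* [aux' <= - e / t]; the second term cancels the friction part of the first,
   and the coefficient of the energy leaves [- |v|^2 / (2 t)] *)
pose aux t := radial x v c t * t^-1
  + (alpha + 1) * (half_sqdist x c t * (t^-1) ^+ 2)
  + 3 / (2 * alpha) * energy F x v t.
pose E1 := energy F x v t1.
have aux_ge t : t1 <= t -> - ((D + enorm c) * (1 + 2 * E1) * t1^-1) <= aux t.
  move=> t1t; have t0 := lt_le_trans t1_gt0 t1t.
  have ti0 : 0 <= t^-1 by rewrite invr_ge0 ltW.
  have rad : - ((D + enorm c) * (1 + 2 * E1) * t1^-1) <= radial x v c t * t^-1.
    apply: le_trans (_ : - (`|radial x v c t| * t^-1) <= _); last first.
      by rewrite -mulNr ler_wpM2r// lerNl -normrN ler_norm.
    rewrite lerN2; apply: ler_pM => //; last by rewrite lef_pV2 ?posrE.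
      apply: le_trans (radial_bounded c D0 xD t1t) _.
      rewrite ler_wpM2l ?addr_ge0 ?enorm_ge0//.
      have := sqr_speed_le_energy t; rewrite -enorm_sqr.
      have := energy_nonincreasing (lexx _) t1t; rewrite -/E1.
      by have := sqr_ge0 (enorm (v t) - 1); have := enorm_ge0 (v t); nra.
  apply: le_trans rad _; rewrite /aux -addrA lerDl addr_ge0//.
    apply: mulr_ge0; first by rewrite addr_ge0// ltW.
    by rewrite mulr_ge0 ?sqr_ge0// divr_ge0 ?dotp_ge0.
  by rewrite mulr_ge0 ?energy_ge0// divr_ge0// mulr_ge0// ltW.
set B := (D + enorm c) * (1 + 2 * E1) * t1^-1 in aux_ge.
(* [aux + e(T) ln] is nonincreasing up to [T], because [e(T) <= e(s)] *)
have log_bound T : t1 <= T ->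
    energy F x v T * (ln T - ln t1) <= aux t1 + B.
  move=> t1T.
  suff : aux T + energy F x v T * ln T <= aux t1 + energy F x v T * ln t1.
    by have := aux_ge T t1T; nra.
  apply: (@ler_of_derive_le0 _ (fun s => aux s + energy F x v T * ln s)) => //.
  move=> s /andP[t1s sT]; have s0 := lt_le_trans t1_gt0 t1s.
  have dE := derive_energy flow t1s; have dq := derive_half_sqdist flow c t1s.
  have dr := derive_radial flow c t1s.
  eexists; first by rewrite /aux; repeat derive_step.
  have ET := energy_nonincreasing t1s sT.
  have Fw := gap_le_work s Fc.
  have qs : 0 <= half_sqdist x c s by rewrite divr_ge0 ?dotp_ge0.
  have sn0 : s != 0 by rewrite gt_eqF.
  have an0 : alpha != 0 by rewrite gt_eqF.
  rewrite [leLHS](_ : _ = (energy F x v T - energy F x v s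
      + (gap F x s - work F x c s)) / s
      - 2 * (alpha + 1) * half_sqdist x c s / s ^+ 3); last first.
    by rewrite /energy; field; rewrite sn0.
  have : 0 <= 2 * (alpha + 1) * half_sqdist x c s / s ^+ 3.
    apply: divr_ge0; last by rewrite exprn_ge0// ltW.
    by apply: mulr_ge0 => //; have := alpha_gt0; lra.
  have : (energy F x v T - energy F x v s + (gap F x s - work F x c s)) / s <= 0.
    by rewrite pmulr_lle0 ?invr_gt0//; lra.
  by lra.
pose T0 := t1 * expR ((`|aux t1 + B| + 1) / eps).
have logT0 : ln T0 - ln t1 = (`|aux t1 + B| + 1) / eps.
  by rewrite lnM ?posrE ?expR_gt0// expRK addrAC subrr add0r.
have t1T0 : t1 <= T0.
  by rewrite ler_peMr ?(ltW t1_gt0)// -expR0 ler_expR divr_ge0 ?addr_ge0// ltW.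
exists T0; split; first exact: num_real.
move=> t /ltW T0t; apply: le_lt_trans (energy_nonincreasing t1T0 T0t) _.
have := log_bound T0 t1T0; rewrite logT0 mulrA ler_pdivrMr// => H.
rewrite -(@ltr_pM2r _ (`|aux t1 + B| + 1)); last by rewrite ltr_pwDr.
apply: le_lt_trans H _; rewrite [ltRHS]mulrC ltr_pM2r//.
by rewrite (le_lt_trans (ler_norm _))// ltrDl.
Qed.

End EnergyDecay.

(** * The energy is negligible with respect to the inverse square of time *)

Section FastDecay.
Context {R : realType} {n : nat} (F : 'rV[R]_n -> R) (x v : R -> 'rV[R]_n).
Variables (lam t1 : R).
Hypothesis argmin_nonempty : argmin F !=set0.
Hypothesis lam_gt0 : 0 < lam.
Hypothesis flow : damped_flow F (2 * lam + 1) t1 x v.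
Implicit Types (s t : R) (c : 'rV[R]_n).

Let t1_gt0 : 0 < t1 := flow_start_gt0 flow.
Let alpha_gt0 : 0 < 2 * lam + 1. Proof. by have := lam_gt0; lra. Qed.

(** A Lyapunov function for a moving centre, of which only the radial speed [m]
    and a primitive [phi] of it appear.  The exponent available is
    [(lam + 1) / lam], half of the critical one; this is enough because only
    boundedness of [E] is wanted: [E' <= - k t e] with [E] bounded below makes
    [t e] integrable, and [e] is nonincreasing. *)
Lemma sqr_time_energy_vanishes (m phi : R -> R) (D C : R) :
  (forall t, t1 <= t -> is_derive t 1 phi (m t)) ->
  (forall t, t1 <= t -> exists2 dm, is_derive t 1 m dm &
     dm <= dotp (v t) (v t) - (2 * lam + 1) / t * m t
           - (lam + 1) / lam * gap F x t) ->
  (forall t, t1 <= t -> - (D * enorm (v t)) <= m t) ->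
  (forall t, t1 <= t -> - C <= phi t) ->
  forall eps, 0 < eps -> \forall t \near +oo, t ^+ 2 * energy F x v t < eps.
Proof.
move=> dphi dm mD phiC eps eps0.
(* between [2 lam / (lam + 1)], needed to beat [2 t (F - inf F)], and [2 lam],
   where friction no longer absorbs the kinetic term *)
pose mu := lam * (lam + 2) / (lam + 1).
pose k := lam ^+ 2 / (lam + 1).
have mu0 : 0 < mu by rewrite divr_gt0 ?mulr_gt0 ?addr_gt0.
have k0 : 0 < k by rewrite divr_gt0 ?exprn_gt0 ?addr_gt0.
have muE : 2 * lam - mu = k by rewrite /mu /k; field; rewrite gt_eqF// addr_gt0.
have kl : k <= lam.
  by rewrite /k ler_pdivrMr ?addr_gt0//; have := sqr_ge0 lam; have := lam_gt0; nra.
pose E t := t ^+ 2 * energy F x v t + mu * (t * m t) + mu * (2 * lam) * phi t.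
have dE t : t1 <= t -> exists2 d, is_derive t 1 E d &
    d <= - k * t * energy F x v t.
  move=> t1t; have t0 := lt_le_trans t1_gt0 t1t.
  have de := derive_energy flow t1t; have dph := dphi t t1t.
  have [m' dm' m'le] := dm t t1t.
  eexists; first by rewrite /E; repeat derive_step.
  have g0 := gap_ge0 x argmin_nonempty t.
  have v0 := dotp_ge0 (v t).
  have tm : t * m' <= t * (dotp (v t) (v t)) - (2 * lam + 1) * m t
      - (lam + 1) / lam * (t * gap F x t).
    apply: le_trans (ler_wpM2l (ltW t0) m'le) _.
    rewrite le_eqVlt; apply/orP; left; apply/eqP; field.
    by rewrite !gt_eqF.
  have mug : mu * ((lam + 1) / lam * (t * gap F x t)) = (lam + 2) * (t * gap F x t).
    by rewrite /mu; field; rewrite !gt_eqF// addr_gt0.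
  have := ler_wpM2l (ltW mu0) tm; rewrite mulrBr mug => tm'.
  have te : t ^+ 2 * (- ((2 * lam + 1) / t) * dotp (v t) (v t)) =
      - (2 * lam + 1) * (t * dotp (v t) (v t)).
    by field; rewrite gt_eqF.
  rewrite te /energy.
  have tv0 : 0 <= t * dotp (v t) (v t) by rewrite mulr_ge0// ltW.
  have tg0 : 0 <= t * gap F x t by rewrite mulr_ge0// ltW.
  have mua : mu * (t * dotp (v t) (v t)) =
      2 * lam * (t * dotp (v t) (v t)) - k * (t * dotp (v t) (v t)).
    by rewrite -muE; ring.
  have ka : 0 <= k * (t * dotp (v t) (v t)) by rewrite mulr_ge0// ltW.
  have kb := ler_wpM2r tg0 kl.
  by lra.
have E_le s t : t1 <= s -> s <= t -> E t <= E s.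
  move=> t1s st; apply: ler_of_derive_le0 => // r /andP[sr _].
  have t1r := le_trans t1s sr; have r0 := lt_le_trans t1_gt0 t1r.
  have [d Ed dle] := dE r t1r; exists d => //; apply: le_trans dle _.
  by rewrite mulNr mulNr oppr_le0 mulr_ge0 ?energy_ge0// mulr_ge0// ltW.
have E_ge t : t1 <= t -> - (mu ^+ 2 * D ^+ 2 / 2 + mu * (2 * lam) * C) <= E t.
  move=> t1t; have t0 := lt_le_trans t1_gt0 t1t.
  have h1 : mu * (t * - (D * enorm (v t))) <= mu * (t * m t).
    by rewrite ler_wpM2l ?(ltW mu0)// ler_wpM2l ?(ltW t0) ?mD.
  have h2 : mu * (2 * lam) * - C <= mu * (2 * lam) * phi t.
    by rewrite ler_wpM2l ?phiC// mulr_ge0 ?(ltW mu0)// mulr_ge0// ltW.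
  have h3 : 0 <= t ^+ 2 * gap F x t by rewrite mulr_ge0 ?sqr_ge0 ?gap_ge0.
  have h4 := sqr_ge0 (t * enorm (v t) - mu * D).
  by rewrite /E /energy -enorm_sqr; nra.
pose B := E @` [set t | t1 <= t].
have lbB : has_inf B.
  split; first by exists (E t1); exists t1 => //=.
  exists (- (mu ^+ 2 * D ^+ 2 / 2 + mu * (2 * lam) * C)) => _ [t t1t <-].
  exact: E_ge.
have keps : 0 < k * eps * (3 / 8) by apply: mulr_gt0; [exact: mulr_gt0|lra].
(* a time [S] after which [E] can only lose little; compare [2 S <= T] with it *)
have [_ [S t1S <-] ES] := inf_adherent keps lbB.
exists (2 * S); split; first exact: num_real.
move=> T /ltW ST; have S0 := lt_le_trans t1_gt0 t1S.
have ST' : S <= T by lra.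
have T0 := lt_le_trans S0 ST'.
have EI : inf B <= E T.
  apply: ge_inf; first by case: lbB.
  by exists T => //=; exact: le_trans ST'.
have : E T + k * energy F x v T * (T ^+ 2 / 2) <=
       E S + k * energy F x v T * (S ^+ 2 / 2).
  apply: (@ler_of_derive_le0 _
    (fun s => E s + k * energy F x v T * (s ^+ 2 / 2))) => //.
  move=> s /andP[Ss sT]; have t1s := le_trans t1S Ss.
  have s0 := lt_le_trans t1_gt0 t1s.
  have [d dEs dle] := dE s t1s.
  eexists; first by repeat derive_step.
  have eT := energy_nonincreasing alpha_gt0 flow t1s sT.
  have : 0 <= k * s by rewrite mulr_ge0// ltW.
  by move=> /ler_wpM2l/(_ _ _ eT); lra.
have Tsq : S ^+ 2 <= T ^+ 2 / 4 by nra.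
have eT0 : 0 <= k * energy F x v T by rewrite mulr_ge0 ?energy_ge0// ltW.
have := ler_wpM2l eT0 Tsq.
rewrite -(@ltr_pM2l _ (k * (3 / 8))); last by apply: mulr_gt0 => //; lra.
by lra.
Qed.

End FastDecay.

(** * A soft average of finitely many centres *)

Section SoftCenter.
Context {R : realType} {n : nat} (F : 'rV[R]_n -> R) (x v : R -> 'rV[R]_n).
Variables (alpha t1 : R).
Hypothesis flow : damped_flow F alpha t1 x v.
Variables (zs : seq 'rV[R]_n) (eta : 'rV[R]_n -> R) (beta : R).
Hypothesis zs_nonempty : (0 < size zs)%N.
Hypothesis beta_gt0 : 0 < beta.
Implicit Types (s t : R) (z : 'rV[R]_n).

(** Gibbs weights of inverse temperature [beta] for the power diagram of the
    balls of centre [z] and radius [eta z]: the largest weight belongs to the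
    ball that contains the position most deeply. *)
Definition soft_weight z t := expR (beta * (eta z ^+ 2 - 2 * half_sqdist x z t)).
Definition soft_total t := \sum_(z <- zs) soft_weight z t.
(** The radial speed with respect to the averaged centre
    [\sum_z p_z z], with [p_z := soft_weight z / soft_total]. *)
Definition soft_radial t :=
  (\sum_(z <- zs) soft_weight z t * radial x v z t) * (soft_total t)^-1.
(** A log-sum-exp; it plays the part of half the squared distance to the
    averaged centre, see [derive_soft_potential]. *)
Definition soft_potential t := - (2 * beta)^-1 * ln (soft_total t).

Lemma soft_weight_gt0 z t : 0 < soft_weight z t.
Proof. exact: expR_gt0. Qed.

Lemma soft_weight_le_total z t : z \in zs -> soft_weight z t <= soft_total t.
Proof.
move=> zzs; rewrite /soft_total (perm_big _ (perm_to_rem zzs)) big_cons lerDl.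
by apply: sumr_ge0 => y _; exact/ltW/soft_weight_gt0.
Qed.

Lemma soft_total_gt0 t : 0 < soft_total t.
Proof.
case: zs zs_nonempty (@soft_weight_le_total) => // z l _ H.
exact: lt_le_trans (soft_weight_gt0 z t) (H z t (mem_head _ _)).
Qed.

Lemma derive_soft_weight z t : t1 <= t ->
  is_derive t 1 (soft_weight z)
    (- (2 * beta) * (soft_weight z t * radial x v z t)).
Proof.
move=> t1t; have dq := derive_half_sqdist flow z t1t.
rewrite /soft_weight; eapply is_derive_eq; first by repeat derive_step.
by ring.
Qed.

Lemma derive_soft_total t : t1 <= t ->
  is_derive t 1 soft_total
    (- (2 * beta) * \sum_(z <- zs) soft_weight z t * radial x v z t).
Proof.
move=> t1t; rewrite mulr_sumr; apply: derive_sum_fun => z.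
exact: derive_soft_weight.
Qed.

Lemma derive_soft_potential t : t1 <= t ->
  is_derive t 1 soft_potential (soft_radial t).
Proof.
move=> t1t; have dT := derive_soft_total t1t; have T0 := soft_total_gt0 t.
rewrite /soft_potential; eapply is_derive_eq.
  by repeat derive_step.
by rewrite /soft_radial; field; rewrite !gt_eqF.
Qed.

(** Cauchy-Schwarz for the weights, as the nonnegativity of a variance. *)
Lemma sqr_sum_soft_le t (a : 'rV[R]_n -> R) :
  (\sum_(z <- zs) soft_weight z t * a z) ^+ 2 <=
  soft_total t * \sum_(z <- zs) soft_weight z t * a z ^+ 2.
Proof.
have T0 := soft_total_gt0 t; set B := \sum_(z <- zs) soft_weight z t * a z.
have : 0 <= \sum_(z <- zs) soft_weight z t * (soft_total t * a z - B) ^+ 2.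
  by apply: sumr_ge0 => z _; rewrite mulr_ge0 ?sqr_ge0// ltW ?soft_weight_gt0.
rewrite (eq_bigr (fun z => soft_total t ^+ 2 * (soft_weight z t * a z ^+ 2)
   + (- (2 * soft_total t * B) * (soft_weight z t * a z) + B ^+ 2 * soft_weight z t))).
  rewrite 2!big_split /= -!mulr_sumr -/B -/(soft_total t).
  set Q := (\sum_(z <- zs) _) => H.
  rewrite -subr_ge0 -(pmulr_rge0 _ T0); lra.
by move=> z _; ring.
Qed.

(** The centre [\sum_z p_z z] moves monotonically with the position, so its
    motion only lowers the derivative: differentiating the weights contributes
    [- 2 beta] times the variance of the radial speeds. *)
Lemma derive_soft_radial_le t (g : R) : t1 <= t ->
  g * soft_total t <= \sum_(z <- zs) soft_weight z t * work F x z t ->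
  exists2 d, is_derive t 1 soft_radial d &
    d <= dotp (v t) (v t) - alpha / t * soft_radial t - g.
Proof.
move=> t1t gle; have T0 := soft_total_gt0 t.
have dT := derive_soft_total t1t.
have dS : is_derive t 1 (fun s => \sum_(z <- zs) soft_weight z s * radial x v z s)
  (\sum_(z <- zs) (- (2 * beta) * (soft_weight z t * radial x v z t) * radial x v z t
     + soft_weight z t * (dotp (v t) (v t) - alpha / t * radial x v z t - work F x z t))).
  apply: derive_sum_fun => z; have dw := derive_soft_weight z t1t.
  by have dr := derive_radial flow z t1t; repeat derive_step.
eexists; first by rewrite /soft_radial; repeat derive_step.
set M := \sum_(z <- zs) soft_weight z t * radial x v z t.
pose Q := \sum_(z <- zs) soft_weight z t * radial x v z t ^+ 2.
pose W := \sum_(z <- zs) soft_weight z t * work F x z t.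
rewrite (eq_bigr (fun z => - (2 * beta) * (soft_weight z t * radial x v z t ^+ 2)
  + (dotp (v t) (v t) * soft_weight z t + (- (alpha / t) * (soft_weight z t * radial x v z t)
     + - 1 * (soft_weight z t * work F x z t))))); last by move=> z _; ring.
rewrite 3!big_split /= -!mulr_sumr -/M -/(soft_total t) -/Q -/W.
have MQ : M ^+ 2 <= soft_total t * Q := sqr_sum_soft_le t _.
rewrite /soft_radial -/M [leLHS](_ : _ = dotp (v t) (v t) - alpha / t * (M / soft_total t)
  - W / soft_total t
  - 2 * beta * (soft_total t * Q - M ^+ 2) / soft_total t ^+ 2); last first.
  have t0 := lt_le_trans (flow_start_gt0 flow) t1t.
  by field; rewrite !gt_eqF.
have : 0 <= 2 * beta * (soft_total t * Q - M ^+ 2) / soft_total t ^+ 2.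
  by rewrite divr_ge0 ?sqr_ge0// mulr_ge0 ?subr_ge0// mulr_ge0// ltW.
have : g <= W / soft_total t by rewrite ler_pdivlMr.
by lra.
Qed.

(** A point [z] too far away has weight at most [1], and the total weight is
    large, so the bad points cannot spoil more than half of the estimate. *)
Lemma soft_work_ge t (gamma : R) : 0 <= gamma -> 0 <= gap F x t ->
  (forall z, z \in zs -> 0 <= work F x z t) ->
  (forall z, z \in zs -> enorm (x t - z) < eta z ->
     gamma * gap F x t <= work F x z t) ->
  (forall z, 0 <= eta z) ->
  2 * (size zs)%:R <= soft_total t ->
  gamma / 2 * gap F x t * soft_total t <=
    \sum_(z <- zs) soft_weight z t * work F x z t.
Proof.
move=> gam0 g0 w0 wz eta0 N2.
(* termwise: a point outside its ball has [soft_weight z t <= 1] *)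
have H : \sum_(z <- zs) gamma * gap F x t * (soft_weight z t - 1) <=
         \sum_(z <- zs) soft_weight z t * work F x z t.
  rewrite !big_seq; apply: ler_sum => z zzs.
  have p0 := soft_weight_gt0 z t; have gg0 : 0 <= gamma * gap F x t by rewrite mulr_ge0.
  have [near_|far] := ltP (enorm (x t - z)) (eta z).
    apply: le_trans (_ : gamma * gap F x t * soft_weight z t <= _).
      by rewrite ler_wpM2l// gerBl.
    by rewrite mulrC ler_wpM2l ?(ltW p0)// wz.
  apply: (@le_trans _ _ 0); last by rewrite mulr_ge0 ?(ltW p0)// w0.
  rewrite mulr_ge0_le0// subr_le0 -expR0 ler_expR pmulr_rle0//.
  rewrite /half_sqdist mulrCA divff// mulr1 subr_le0 -enorm_sqr.
  by rewrite ler_pXn2r// nnegrE ?enorm_ge0.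
apply: le_trans H; rewrite -mulr_sumr big_split /= sumrN -/(soft_total t).
have -> : \sum_(z <- zs) (1 : R) = (size zs)%:R.
  by rewrite big_const_seq count_predT iter_addr_0.
have : 0 <= gamma * gap F x t by rewrite mulr_ge0.
by move=> /ler_wpM2l/(_ _ _ N2); lra.
Qed.

Lemma soft_radial_bounded t D : (forall z, z \in zs -> `|radial x v z t| <= D) ->
  - D <= soft_radial t.
Proof.
move=> rD; rewrite /soft_radial ler_pdivlMr ?soft_total_gt0// mulrC /soft_total.
rewrite mulr_suml !big_seq; apply: ler_sum => z zzs.
rewrite ler_wpM2l ?(ltW (soft_weight_gt0 _ _))// lerNl.
by rewrite (le_trans _ (rD z zzs))// -normrN ler_norm.
Qed.

Lemma soft_potential_bounded : exists C, forall t, - C <= soft_potential t.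
Proof.
pose T := \sum_(z <- zs) expR (beta * eta z ^+ 2).
have TT t : soft_total t <= T.
  apply: ler_sum => z _; rewrite ler_expR ler_wpM2l ?(ltW beta_gt0)//.
  by rewrite gerBl mulr_ge0// divr_ge0 ?dotp_ge0.
exists ((2 * beta)^-1 * ln T) => t.
rewrite /soft_potential mulNr lerN2 ler_wpM2l ?invr_ge0 ?mulr_ge0 ?(ltW beta_gt0)//.
have T0 := soft_total_gt0 t.
by rewrite ler_ln ?TT// posrE// (lt_le_trans T0).
Qed.

End SoftCenter.

(** * Fast decay of the energy from local flatness *)

Section Minimizers.
Context {R : realType} {n : nat} (F : 'rV[R]_n -> R).
Hypothesis F_continuous : continuous F.
Implicit Types (y z c : 'rV[R]_n).

Lemma closed_argmin : closed (argmin F).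
Proof.
rewrite (_ : argmin F = \bigcap_y (F @^-1` [set a | a <= F y])).
  by apply: closed_bigI => y _; apply: closed_comp => //; exact: closed_le.
by apply/seteqP; split => [c Fc y _|c Fc y]; [exact: Fc|exact: (Fc y)].
Qed.

Lemma compact_argmin : coercive F -> compact (argmin F).
Proof.
have [[c Fc]|F0] := pselect (argmin F !=set0).
  move=> /(coercive_sublevel_bounded (F c))[D HD].
  by apply: (compact_of_enorm_bounded closed_argmin) => y Fy; exact/HD/Fy.
rewrite (_ : argmin F = set0) => [_|]; first exact: compact0.
by apply/seteqP; split => // c Fc; apply: F0; exists c.
Qed.

(** Compactness: on the part of a ball outside [U] the function [F] attains a
    minimum, larger than its infimum. *)
Lemma almost_minimizer_in_open (U : set 'rV[R]_n) (D : R) : argmin F !=set0 ->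
  open U -> argmin F `<=` U ->
  exists2 w, 0 < w & forall y, enorm y <= D -> F y < infval F + w -> U y.
Proof.
move=> [c Fc] oU FU.
pose K := [set y | enorm y <= D] `&` ~` U.
have Kc : compact K.
  apply: (@compact_of_enorm_bounded _ _ _ D) => [|y []//].
  apply: closedI; last exact: open_closedC.
  exact: (closed_enorm_preimage (@closed_le R D)).
have [K0|K0] := pselect (K !=set0); last first.
  exists 1 => // y yD _; apply: contrapT => Uy; apply: K0.
  by exists y.
have cF : {within K, continuous F} by apply: continuous_subspaceT.
have [k] := EVT_min_rV K0 Kc cF; rewrite inE => -[kD kU] kmin.
exists (F k - infval F).
  rewrite subr_gt0 (infval_argmin Fc) lt_neqAle Fc andbT.
  apply/eqP => Fck; apply/kU/FU => y; rewrite -Fck; exact: Fc.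
move=> y yD; rewrite addrCA subrr addr0 => Fyk; apply: contrapT => Uy.
have : F k <= F y by apply: kmin; rewrite inE.
by rewrite leNgt Fyk.
Qed.

End Minimizers.

Lemma seq_pos_lower_bound (R : realType) (T : eqType) (s : seq T) (f : T -> R) :
  (forall z, z \in s -> 0 < f z) ->
  exists2 d, 0 < d & forall z, z \in s -> d <= f z.
Proof.
elim: s => [_|a s IH fs]; first by exists 1.
have [|d d0 ds] := IH; first by move=> z zs; rewrite fs// inE zs orbT.
exists (Num.min (f a) d); first by rewrite lt_min d0 fs// mem_head.
by move=> z; rewrite inE ge_min => /predU1P[->|/ds ->]; rewrite ?lexx ?orbT.
Qed.

Lemma H1_work (R : realType) n (F : 'rV[R]_n -> R) (gamma : R) c :
  0 < gamma -> H1 F gamma -> argmin F c ->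
  exists2 eta, 0 < eta & forall y, enorm (y - c) < eta ->
    gamma * (F y - infval F) <= dotp (gradient F y) (y - c).
Proof.
move=> gam0 h1 /h1[eta eta0 He]; exists eta => // y /He.
by rewrite mul1r mulrC ler_pdivlMr// mulrC.
Qed.

Section FastDecayOfH1.
Context {R : realType} {n : nat} (F : 'rV[R]_n -> R) (x v : R -> 'rV[R]_n).
Variables (lam t1 : R).
Hypothesis F_convex : convex_function setT F.
Hypothesis F_differentiable : forall y, differentiable F y.
Hypothesis argmin_nonempty : argmin F !=set0.
Hypothesis F_coercive : coercive F.
Hypothesis lam_gt0 : 0 < lam.
Hypothesis F_H1 : H1 F (2 * (lam + 1) / lam).
Hypothesis flow : damped_flow F (2 * lam + 1) t1 x v.

Let F_continuous : continuous F.
Proof. by move=> y; exact: differentiable_continuous. Qed.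

Let gamma_gt0 : 0 < 2 * (lam + 1) / lam.
Proof. by rewrite divr_gt0// mulr_gt0// addr_gt0. Qed.

Let alpha_gt0 : 0 < 2 * lam + 1. Proof. by have := lam_gt0; lra. Qed.

(** The radius on which flatness holds may tend to [0] along the minimizers, so
    no fixed centre is usable before the trajectory is known to converge, and
    neither is the projection onto the minimizers.  Instead the minimizers are
    covered by finitely many balls, and the centre is the soft average of those
    of the balls; [beta] is so large that the deepest ball alone outweighs twice
    the number of centres. *)
Lemma sqr_time_energy_vanishes_of_H1 : forall eps, 0 < eps ->
  \forall t \near +oo, t ^+ 2 * energy F x v t < eps.
Proof.
have : forall z, exists r, 0 < r /\ (argmin F z -> forall y, enorm (y - z) < r ->
    2 * (lam + 1) / lam * (F y - infval F) <= dotp (gradient F y) (y - z)).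
  move=> z; have [Fz|Fz] := pselect (argmin F z); last by exists 1.
  by have [r r0 Hr] := H1_work gamma_gt0 F_H1 Fz; exists r.
move=> /choice[eta etaP].
have eta_gt0 z : 0 < eta z by case: (etaP z).
have eta2_gt0 z : 0 < eta z / 2 by rewrite divr_gt0.
(* half radii leave a margin [3 / 4 eta^2] in the exponent of the weight *)
have [zs zsF zs_cover] := finite_eball_cover (rad := fun z => eta z / 2)
  (compact_argmin F_continuous F_coercive) (fun z _ => eta2_gt0 z).
have zs_nonempty : (0 < size zs)%N.
  have [c /zs_cover[z]] := argmin_nonempty.
  by case: (zs).
have [D D0 xD] := flow_bounded alpha_gt0 flow F_coercive.
have oU : open (\bigcup_(z in [set` zs]) eball z (eta z / 2)).
  by apply: bigcup_open => z _; exact: open_eball.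
have FU : argmin F `<=` \bigcup_(z in [set` zs]) eball z (eta z / 2).
  by move=> y /zs_cover[z zzs yz]; exists z.
have [w w0 Hw] := almost_minimizer_in_open F_continuous D argmin_nonempty oU FU.
have [T1 [_ ET1]] := energy_vanishes F_convex F_differentiable argmin_nonempty
  alpha_gt0 flow F_coercive w0.
pose T := Num.max t1 (T1 + 1).
have t1T : t1 <= T by rewrite le_max lexx.
have T1T t : T <= t -> T1 < t.
  by move=> Tt; apply: lt_le_trans Tt; rewrite lt_max ltrDl ltr01 orbT.
have near_zs t : T <= t -> exists2 z, z \in zs & enorm (x t - z) < eta z / 2.
  move=> Tt; have [|z zzs xz] := Hw (x t) (xD _ (le_trans t1T Tt)); last by exists z.
  rewrite -ltrBlDl; apply: le_lt_trans (ET1 _ (T1T _ Tt)).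
  exact: gap_le_energy.
have flowT := damped_flowW t1T flow.
have [d d0 dP] := seq_pos_lower_bound (s := zs) (f := eta) (fun z _ => eta_gt0 z).
have N0 : 0 < (size zs)%:R :> R by rewrite ltr0n.
pose beta := 8 * (size zs)%:R / (3 * d ^+ 2).
have beta0 : 0 < beta by rewrite divr_gt0 ?mulr_gt0 ?exprn_gt0.
have [c Fc] := argmin_nonempty.
have [D2 HD2] := coercive_sublevel_bounded (F c) F_coercive.
have [C HC] := soft_potential_bounded (n := n) x eta zs_nonempty beta0.
apply: (@sqr_time_energy_vanishes _ _ F x v lam T argmin_nonempty lam_gt0 flowT
  (soft_radial x v zs eta beta) (soft_potential x zs eta beta) (D + D2) C).
- by move=> t Tt; exact: (derive_soft_potential flowT).
- move=> t Tt.
  have [z zzs xz] := near_zs t Tt.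
  apply: (derive_soft_radial_le flowT) => //.
  rewrite [X in X * soft_total _ _ _ _ _ <= _](_ : _ =
    (2 * (lam + 1) / lam) / 2 * gap F x t); last by field; rewrite gt_eqF.
  apply: soft_work_ge => //.
  + exact: ltW.
  + exact: gap_ge0.
  + move=> y /zsF Fy; apply: le_trans (gap_ge0 x argmin_nonempty t) _.
    exact: gap_le_work.
  + by move=> y /zsF Fy; exact: (etaP y).2.
  + by move=> y; exact: ltW.
  + apply: (le_trans _ (soft_weight_le_total x eta beta t zzs)).
    apply: (le_trans _ (expR_ge1Dx _)).
    have xz2 : dotp (x t - z) (x t - z) <= eta z ^+ 2 / 4.
      rewrite -enorm_sqr (_ : eta z ^+ 2 / 4 = (eta z / 2) ^+ 2); last by field.
      by rewrite ler_pXn2r ?nnegrE ?enorm_ge0 ?(ltW xz)// ltW.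
    have dz : d ^+ 2 <= eta z ^+ 2.
      by rewrite ler_pXn2r ?nnegrE ?dP// ltW.
    have : beta * (3 / 4 * d ^+ 2) <= beta * (eta z ^+ 2 - 2 * half_sqdist x z t).
      by rewrite ler_wpM2l ?(ltW beta0)// /half_sqdist; lra.
    have -> : beta * (3 / 4 * d ^+ 2) = 2 * (size zs)%:R.
      by rewrite /beta; field; rewrite gt_eqF.
    by lra.
- move=> t Tt; apply: (soft_radial_bounded _ _ zs_nonempty) => z zzs.
  apply: le_trans (radial_bounded v z D0 xD (le_trans t1T Tt)) _.
  rewrite ler_wpM2r ?enorm_ge0// lerD2l; exact/HD2/(zsF z zzs).
- by move=> t _; exact: HC.
Qed.

End FastDecayOfH1.

(** * Convergence of the trajectory *)

Section Convergence.
Context {R : realType} {n : nat} (F : 'rV[R]_n -> R) (x v : R -> 'rV[R]_n).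
Variables (lam t1 : R).
Hypothesis argmin_nonempty : argmin F !=set0.
Hypothesis lam_gt0 : 0 < lam.
Hypothesis flow : damped_flow F (2 * lam + 1) t1 x v.
Implicit Types (s t a b C : R) (c : 'rV[R]_n).

Let t1_gt0 : 0 < t1 := flow_start_gt0 flow.

Definition potential c t :=
  t `^ (2 * lam) * (t ^+ 2 * energy F x v t + lam * (t * radial x v c t)).

(** With this damping and this weight all the terms in [v] cancel:
    [S' = lam t^(2 lam + 1) (gamma (F(x) - inf F) - <grad F(x), x - c>)] where
    [gamma := 2 (lam + 1) / lam]. *)
Lemma potential_nonincreasing c a b : t1 <= a -> a <= b ->
  (forall s, a <= s <= b -> 2 * (lam + 1) / lam * gap F x s <= work F x c s) ->
  potential c b <= potential c a.
Proof.
move=> t1a ab Hw; apply: ler_of_derive_le0 => // s /[dup] sab /andP[as_ _].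
have t1s := le_trans t1a as_; have s0 := lt_le_trans t1_gt0 t1s.
have dE := derive_energy flow t1s; have dr := derive_radial flow c t1s.
eexists; first by rewrite /potential; repeat derive_step.
rewrite [leLHS](_ : _ = - (s `^ (2 * lam) * s * lam) *
    (work F x c s - 2 * (lam + 1) / lam * gap F x s)); last first.
  by rewrite /energy; field; rewrite !gt_eqF.
rewrite mulNr oppr_le0 mulr_ge0 ?subr_ge0 ?Hw//.
by rewrite !mulr_ge0 ?powR_ge0// ltW.
Qed.

Lemma radial_le_of_potential c t C : 0 < t -> potential c t <= C ->
  lam * radial x v c t <= C * (t `^ (- (2 * lam)) / t) - t * energy F x v t.
Proof.
move=> t0; have P0 : 0 < t `^ (2 * lam) by rewrite powR_gt0.
rewrite /potential powRN => H.
rewrite -(@ler_pM2l _ (t * t `^ (2 * lam))) ?mulr_gt0//.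
rewrite [leRHS](_ : _ = C - t `^ (2 * lam) * (t ^+ 2 * energy F x v t)); last first.
  by field; rewrite !gt_eqF.
by lra.
Qed.

(** [lam |x - c|^2 / 2 + C / (2 lam) t^(- 2 lam)] is nonincreasing: bounding the
    potential by [C] bounds the derivative of the first term. *)
Lemma sqdist_almost_nonincreasing c a b C : t1 <= a -> a <= b ->
  (forall s, a <= s <= b -> 2 * (lam + 1) / lam * gap F x s <= work F x c s) ->
  0 <= C -> potential c a <= C ->
  lam * half_sqdist x c b <=
    lam * half_sqdist x c a + C / (2 * lam) * a `^ (- (2 * lam)).
Proof.
move=> t1a ab Hw C0 HC.
suff : lam * half_sqdist x c b + C / (2 * lam) * b `^ (- (2 * lam)) <=
    lam * half_sqdist x c a + C / (2 * lam) * a `^ (- (2 * lam)).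
  apply: le_trans; rewrite lerDl mulr_ge0 ?powR_ge0// divr_ge0// mulr_ge0//.
  exact: ltW.
apply: (@ler_of_derive_le0 _ (fun s => lam * half_sqdist x c s
    + C / (2 * lam) * s `^ (- (2 * lam)))) => // s /andP[as_ sb].
have t1s := le_trans t1a as_; have s0 := lt_le_trans t1_gt0 t1s.
have dq := derive_half_sqdist flow c t1s.
eexists; first by repeat derive_step.
have Ss : potential c s <= C.
  apply: le_trans HC; apply: potential_nonincreasing => // r /andP[ar rs].
  by rewrite Hw// ar (le_trans rs).
have := radial_le_of_potential s0 Ss.
have : 0 <= s * energy F x v s by rewrite mulr_ge0 ?energy_ge0// ltW.
rewrite [C / (2 * lam) * _](_ : _ = - (C * (s `^ (- (2 * lam)) / s))); last first.
  by field; rewrite !gt_eqF.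
by lra.
Qed.

Hypothesis F_convex : convex_function setT F.
Hypothesis F_differentiable : forall y, differentiable F y.
Hypothesis F_coercive : coercive F.
Hypothesis F_H1 : H1 F (2 * (lam + 1) / lam).

Let gamma_gt0 : 0 < 2 * (lam + 1) / lam.
Proof. by rewrite divr_gt0// mulr_gt0// addr_gt0. Qed.

Let alpha_gt0 : 0 < 2 * lam + 1. Proof. by have := lam_gt0; lra. Qed.

Lemma exists_cluster_minimizer : exists2 c, argmin F c &
  forall (eps T : R), 0 < eps -> exists2 t, T < t & enorm (x t - c) < eps.
Proof.
have [D D0 xD] := flow_bounded alpha_gt0 flow F_coercive.
have Kc : compact [set y : 'rV[R]_n | enorm y <= D].
  apply: (@compact_of_enorm_bounded _ _ _ D) => //.
  exact: (closed_enorm_preimage (@closed_le R D)).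
have [|c [_ cl]] := Kc (x @ +oo) _.
  exists t1; split; first exact: num_real.
  by move=> t /ltW; exact: xD.
have late T : (x @ +oo) (x @` [set t | T < t]).
  by exists T; split; [exact: num_real|move=> t Tt; exists t].
have near_c (eps T : R) : 0 < eps -> exists2 t, T < t & enorm (x t - c) < eps.
  move=> eps0.
  have nc : nbhs c (eball c eps).
    apply: open_nbhs_nbhs; split; first exact: open_eball.
    by rewrite /eball /= subrr enorm0.
  by have [_ [[t Tt <-] xc]] := cl _ _ (late T) nc; exists t.
exists c => //; have [z Fz] := argmin_nonempty; move=> y.
apply: le_trans (Fz y); rewrite -(infval_argmin Fz) leNgt; apply/negP => Fc.
pose w := (F c - infval F) / 2.
have w0 : 0 < w by rewrite divr_gt0// subr_gt0.
have Fcw : infval F + w < F c by rewrite /w; lra.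
have [T [_ ET]] := energy_vanishes F_convex F_differentiable argmin_nonempty
  alpha_gt0 flow F_coercive w0.
have nc : nbhs c [set y | infval F + w < F y].
  have Fc' : F @ c --> F c by exact: differentiable_continuous.
  exact: (cvgr_gt (F c) Fc' _ Fcw).
have [_ [[t Tt <-] /= Ft]] := cl _ _ (late T) nc.
by have := le_lt_trans (gap_le_energy F x v t) (ET t Tt); rewrite /gap; lra.
Qed.

(** Started close enough to a cluster point [c], at a time when [t^2 e] is small,
    the trajectory cannot leave a small ball around [c]: for as long as it has
    not left it, flatness at [c] makes [sqdist_almost_nonincreasing] available. *)
Lemma flow_converges : exists2 c, argmin F c &
  forall eps, 0 < eps -> \forall t \near +oo, enorm (x t - c) < eps.
Proof.
have [c Fc near_c] := exists_cluster_minimizer; exists c => // eps0 eps0_gt0.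
have [eta eta_gt0 Heta] := H1_work gamma_gt0 F_H1 Fc.
pose eps := Num.min eps0 (eta / 2).
have eps_gt0 : 0 < eps by rewrite lt_min eps0_gt0 divr_gt0.
have eps_eta : eps < eta.
  by rewrite (@le_lt_trans _ _ (eta / 2)) ?ge_min ?lexx ?orbT//; lra.
pose k := lam + (1 + 2 * lam) / (2 * lam).
have k0 : 0 < k by rewrite addr_gt0// divr_gt0 ?addr_gt0// mulr_gt0.
pose d := lam * (eps ^+ 2 / 2) / k.
have d0 : 0 < d by rewrite divr_gt0// mulr_gt0// divr_gt0// exprn_gt0.
have [T [_ ET]] := sqr_time_energy_vanishes_of_H1 F_convex F_differentiable
  argmin_nonempty F_coercive lam_gt0 F_H1 flow d0.
have sd0 : 0 < Num.sqrt d by rewrite sqrtr_gt0.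
have [a] := near_c (Num.sqrt d) (Num.max T t1) sd0.
rewrite gt_max => /andP[Ta /ltW t1a] xa.
have {}xa : half_sqdist x c a < d / 2.
  by rewrite ltr_pM2r// -enorm_sqr -(sqr_sqrtr (ltW d0)) ltr_pXn2r ?nnegrE ?enorm_ge0// ltW.
have ea := ET a Ta; have a0 := lt_le_trans t1_gt0 t1a.
have ea0 := energy_ge0 x v argmin_nonempty a.
have ra : `|a * radial x v c a| <= half_sqdist x c a + a ^+ 2 * energy F x v a.
  rewrite normrM (gtr0_norm a0).
  have : a * `|radial x v c a| <= a * (enorm (x a - c) * enorm (v a)).
    by rewrite ler_wpM2l ?(ltW a0)// normr_dotp_le.
  have := sqr_ge0 (enorm (x a - c) - a * enorm (v a)).
  have : a ^+ 2 * dotp (v a) (v a) <= a ^+ 2 * (2 * energy F x v a).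
    by rewrite ler_wpM2l ?sqr_ge0// sqr_speed_le_energy.
  rewrite /half_sqdist -!enorm_sqr; nra.
have Pa : potential c a * a `^ (- (2 * lam)) <=
    (1 + lam) * (a ^+ 2 * energy F x v a) + lam * half_sqdist x c a.
  rewrite /potential powRN mulrAC divff ?mul1r ?gt_eqF ?powR_gt0//.
  have := le_trans (ler_norm _) ra; have := lam_gt0; nra.
have bound t : a <= t -> half_sqdist x c t < eps ^+ 2 / 2.
  apply: (@continuous_bootstrap _ (half_sqdist x c) a).
  - move=> s as_; have t1s := le_trans t1a as_.
    exact: (continuous_of_derive (derive_half_sqdist flow c t1s)).
  - have : d / 2 <= eps ^+ 2 / 2.
      have e0 : 0 < eps ^+ 2 by rewrite exprn_gt0.
      have h : 0 <= (1 + 2 * lam) / (2 * lam).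
        by rewrite divr_ge0 ?mulr_ge0 ?addr_ge0 ?mulr_ge0// ltW.
      have kl : lam <= k by rewrite lerDl.
      rewrite ler_pM2r// /d ler_pdivrMr//.
      have := ler_wpM2l (ltW e0) kl.
      have : 0 <= eps ^+ 2 * lam by rewrite mulr_ge0// ltW.
      by lra.
    exact: lt_le_trans.
  - move=> s as_ Hs; rewrite -(ltr_pM2l lam_gt0).
    have := @sqdist_almost_nonincreasing c a s (Num.max (potential c a) 0) t1a as_.
    move=> H; apply: le_lt_trans (H _ _ _) _.
    + move=> r ars; apply: Heta; apply: le_lt_trans eps_eta.
      rewrite ler_enorm ?(ltW eps_gt0)//.
      by have := Hs r ars; rewrite ler_pM2r.
    + by rewrite le_max lexx orbT.
    + by rewrite le_max lexx.
    rewrite mulrAC.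
    have Ca : Num.max (potential c a) 0 * a `^ (- (2 * lam)) <= (1 + 2 * lam) * d.
      have q0 : 0 <= half_sqdist x c a by rewrite divr_ge0 ?dotp_ge0.
      rewrite maxr_pMl ?powR_ge0// mul0r ge_max; apply/andP; split.
        by apply: le_trans Pa _; have := lam_gt0; nra.
      by rewrite mulr_ge0 ?(ltW d0)// addr_ge0 ?mulr_ge0// ltW.
    have : Num.max (potential c a) 0 * a `^ (- (2 * lam)) / (2 * lam) <=
           (1 + 2 * lam) * d / (2 * lam).
      by rewrite ler_pM2r// invr_gt0 mulr_gt0.
    have dE : lam * (eps ^+ 2 / 2) = lam * d + (1 + 2 * lam) * d / (2 * lam).
      have -> : lam * (eps ^+ 2 / 2) = d * k by rewrite /d mulfVK ?gt_eqF.
      by rewrite /k; field; rewrite gt_eqF.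
    have : lam * half_sqdist x c a < lam * d by rewrite ltr_pM2l//; lra.
    by rewrite dE; lra.
exists a; split; first exact: num_real.
move=> t /ltW/bound; rewrite ltr_pM2r// -ltr_enorm ?(ltW eps_gt0)//.
by move=> /lt_le_trans; apply; rewrite ge_min lexx.
Qed.

End Convergence.

(** * Almost orthogonality to the set of minimizers *)

Section ConeBound.
Context {R : realType} {n : nat}.
Implicit Types (c e u y d : 'rV[R]_n) (a b L : R).

Lemma uniform_constant_over_seq (T : eqType) (s : seq T) (P : T -> R -> Prop) :
  (forall z : T, exists2 L, 0 < L & P z L) ->
  (forall (z : T) L L', L <= L' -> P z L -> P z L') ->
  exists2 L, 0 < L & forall z : T, z \in s -> P z L.
Proof.
move=> exP Pmono; elim: s => [|z s [L L0 PL]]; first by exists 1.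
have [M M0 PM] := exP z; exists (Num.max L M); first by rewrite lt_max L0.
move=> y; rewrite inE => /predU1P[->|/PL Py].
  by apply: Pmono PM; rewrite le_max lexx orbT.
by apply: Pmono Py; rewrite le_max lexx.
Qed.

Lemma compact_unit_sphere : compact [set e : 'rV[R]_n | enorm e = 1].
Proof.
apply: (@compact_of_enorm_bounded _ _ _ 1) => [|e /= ->//].
exact: (closed_enorm_preimage (@closed_eq R 1)).
Qed.

(** Only the directions of [A] seen from [c] matter, and finitely many of them
    are within [1 / 4] of all the others.  The price of replacing a point close
    to [c] by one of the finitely many witnesses is the factor [L], the inverse
    of their least distance to [c]. *)
Lemma dotp_bound_near_vertex (A : set 'rV[R]_n) c :
  exists2 L, 0 < L & forall u a b, 0 <= a ->
    (forall d, A d -> dotp u (d - c) <= a + b * enorm (d - c)) ->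
    forall y, A y -> dotp u (y - c) <= enorm (y - c) * (L * a + b + enorm u / 4).
Proof.
pose dir y := (enorm (y - c))^-1 *: (y - c).
pose P e L := forall u a b, 0 <= a ->
    (forall d, A d -> dotp u (d - c) <= a + b * enorm (d - c)) ->
    forall y, A y -> 0 < enorm (y - c) -> enorm (dir y - e) < 1 / 8 ->
    dotp u (y - c) <= enorm (y - c) * (L * a + b + enorm u / 4).
have exP e : exists2 L, 0 < L & P e L.
  have [[d [Ad d0 de]]|nod] := pselect (exists d,
      [/\ A d, 0 < enorm (d - c) & enorm (dir d - e) < 1 / 8]); last first.
    by exists 1 => // u a b _ _ y Ay y0 ye; case: nod; exists y.
  exists (enorm (d - c))^-1; first by rewrite invr_gt0.
  move=> u a b a0 Hu y Ay y0 ye.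
  have -> : dotp u (y - c) = enorm (y - c) * dotp u (dir y).
    by rewrite /dir dotpZr mulrA divff ?mul1r// gt_eqF.
  rewrite ler_wpM2l ?(ltW y0)//.
  have -> : dotp u (dir y) = dotp u (dir d) + dotp u (dir y - dir d).
    by rewrite dotpBr addrC subrK.
  apply: lerD.
    rewrite /dir dotpZr mulrC ler_pdivrMr// mulrDl mulrAC mulVf ?mul1r ?gt_eqF//.
    exact: Hu.
  apply: le_trans (dotp_le_enorm _ _) _; rewrite ler_wpM2l ?enorm_ge0//.
  apply: le_trans (enorm_triangle e _ _) _; rewrite (enorm_distC e); lra.
have Pmono e L L' : L <= L' -> P e L -> P e L'.
  move=> LL' PL u a b a0 Hu y Ay y0 ye; apply: le_trans (PL u a b a0 Hu y Ay y0 ye) _.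
  by rewrite ler_wpM2l ?(ltW y0)// !lerD2r ler_wpM2r.
have [s sS scov] := finite_eball_cover (rad := fun=> 1 / 8) compact_unit_sphere
  (fun _ _ => divr_gt0 ltr01 (ltr0Sn _ 7)).
have [L L0 PL] := uniform_constant_over_seq s exP Pmono.
exists L => // u a b a0 Hu y Ay.
have [y0|] := ltP 0 (enorm (y - c)); last first.
  rewrite le_eqVlt ltNge enorm_ge0 orbF => /eqP/[dup] y0 /enorm_eq0 ->.
  by rewrite dotp0r enorm0 mul0r.
have [|e es ye] := scov (dir y); last exact: (PL e es u a b a0 Hu y Ay y0 ye).
by rewrite /= /dir enormZ gtr0_norm ?invr_gt0// mulVf// gt_eqF.
Qed.

End ConeBound.

Section TangentialDrift.
Context {R : realType} {n : nat} (F : 'rV[R]_n -> R) (x v : R -> 'rV[R]_n).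
Variables (lam t1 C : R) (c : 'rV[R]_n).
Hypothesis F_convex : convex_function setT F.
Hypothesis F_differentiable : forall y, differentiable F y.
Hypothesis lam_gt0 : 0 < lam.
Hypothesis flow : damped_flow F (2 * lam + 1) t1 x v.
Hypothesis c_argmin : argmin F c.
Hypothesis energy_small : forall eps, 0 < eps ->
  \forall t \near +oo, t ^+ 2 * energy F x v t < eps.
Hypothesis x_cvg : forall eps, 0 < eps ->
  \forall t \near +oo, enorm (x t - c) < eps.
Hypothesis potential_le : forall t, t1 <= t -> potential F x v lam c t <= C.
Hypothesis C_ge0 : 0 <= C.

Let t1_gt0 : 0 < t1 := flow_start_gt0 flow.
Let argmin_nonempty : argmin F !=set0. Proof. by exists c. Qed.

(** The displacement towards another minimizer [d] is of second order in
    [x - c], up to a negligible power of [t].  Indeed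
    [l := <x - c, d - c>] satisfies
    [(t l' + 2 lam l)' = - t <grad F(x), d - c> >= - t <grad F(x), x - c>],
    and [t <grad F(x), x - c>] is controlled through the identity for the
    potential.  In the proof [W] collects the terms; it is nonincreasing and
    tends to [0]. *)
Lemma tangential_drift d t : argmin F d -> t1 <= t ->
  t * dotp (v t) (d - c) + 2 * lam * dotp (x t - c) (d - c) <=
  2 * (lam + 1) * half_sqdist x c t + C * (lam^-1 + (lam ^+ 2)^-1) * t `^ (- (2 * lam)).
Proof.
move=> Fd t1t.
pose W t := t ^+ 2 * energy F x v t + lam * (t * radial x v c t)
  + (2 * lam ^+ 2 + 2 * lam) * half_sqdist x c t
  + C / lam * t `^ (- (2 * lam))
  - lam * (t * dotp (v t) (d - c) + 2 * lam * dotp (x t - c) (d - c)).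
have W_le s r : t1 <= s -> s <= r -> W r <= W s.
  move=> t1s sr; apply: ler_of_derive_le0 => // p /andP[sp _].
  have t1p := le_trans t1s sp; have p0 := lt_le_trans t1_gt0 t1p.
  have dE := derive_energy flow t1p; have dr := derive_radial flow c t1p.
  have dq := derive_half_sqdist flow c t1p.
  have dl := derive_dotp_fun (curve_derive_subl c (flow_velocity flow t1p))
    (curve_derive_cst p (d - c)).
  have dv := derive_dotp_fun (flow_acceleration flow t1p) (curve_derive_cst p (d - c)).
  eexists; first by rewrite /W; repeat derive_step.
  have d0 : work F x d p >= 0.
    apply: le_trans (gap_ge0 x argmin_nonempty p) _; exact: gap_le_work.
  have gd : dotp (gradient F (x p)) (d - c) = work F x c p - work F x d p.
    by rewrite /work -dotpBr; congr dotp; rewrite opprB [RHS]addrC subrKA.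
  have := radial_le_of_potential p0 (potential_le t1p).
  rewrite !dotp0r (dotpBl (- _)) dotpNl dotpZl gd => rad.
  rewrite [leLHS](_ : _ = - (lam * p * work F x d p) - lam * p * dotp (v p) (v p)
    + 2 * (p * gap F x p + lam * radial x v c p - C * (p `^ (- (2 * lam)) / p))); last first.
    by rewrite /energy; field; rewrite !gt_eqF.
  have : 0 <= lam * p * work F x d p by rewrite !mulr_ge0// ltW.
  have : 0 <= lam * p * dotp (v p) (v p) by rewrite !mulr_ge0 ?dotp_ge0// ltW.
  have : 0 <= p * dotp (v p) (v p) by rewrite mulr_ge0 ?dotp_ge0// ltW.
  move: rad; rewrite /energy; lra.
have W_ge0 : 0 <= W t.
  rewrite leNgt; apply/negP => Wt.
  pose k := lam * (1 + enorm (d - c) * (1 + 2 * lam)).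
  have k0 : 0 < k.
    by rewrite mulr_gt0// ltr_pwDl// mulr_ge0 ?enorm_ge0// addr_ge0// mulr_ge0// ltW.
  pose eps := Num.min 1 (- W t / (2 * k)).
  have eps0 : 0 < eps by rewrite lt_min ltr01 divr_gt0 ?oppr_gt0// mulr_gt0.
  have eps1 : eps <= 1 by rewrite ge_min lexx.
  have epsk : eps * (2 * k) <= - W t.
    have k20 : 0 < 2 * k by rewrite mulr_gt0.
    by rewrite -(ler_pdivlMr _ _ k20) /eps ge_min lexx orbT.
  have eps20 : 0 < eps ^+ 2 / 2 by rewrite divr_gt0// exprn_gt0.
  have [T1 [_ HT1]] := energy_small eps20.
  have [T2 [_ HT2]] := x_cvg eps0.
  pose T := Num.max t (Num.max T1 T2 + 1).
  have tT : t <= T by rewrite le_max lexx.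
  have T12 : Num.max T1 T2 < T by rewrite lt_max ltrDl ltr01 orbT.
  have {}HT1 : T ^+ 2 * energy F x v T < eps ^+ 2 / 2.
    by apply: HT1; apply: le_lt_trans T12; rewrite le_max lexx.
  have t1T := le_trans t1t tT; have T0 := lt_le_trans t1_gt0 t1T.
  have uT : enorm (x T - c) < eps.
    by apply: HT2; apply: le_lt_trans T12; rewrite le_max lexx orbT.
  have vT : T * enorm (v T) < eps.
    rewrite -(@ltr_pXn2r _ 2) ?nnegrE ?mulr_ge0 ?enorm_ge0 ?(ltW eps0) ?(ltW T0)//.
    rewrite exprMn enorm_sqr.
    have : T ^+ 2 * dotp (v T) (v T) <= T ^+ 2 * (2 * energy F x v T).
      by rewrite ler_wpM2l ?sqr_ge0// sqr_speed_le_energy.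
    by lra.
  have rT : - (eps * eps) <= T * radial x v c T.
    rewrite lerNl; apply: le_trans (_ : enorm (x T - c) * (T * enorm (v T)) <= _).
      rewrite mulrCA -mulrN ler_wpM2l ?(ltW T0)//.
      by apply: le_trans (normr_dotp_le _ _); rewrite -normrN ler_norm.
    by rewrite ler_pM ?enorm_ge0 ?mulr_ge0 ?enorm_ge0 ?(ltW uT) ?(ltW vT) ?(ltW T0).
  have lT : T * dotp (v T) (d - c) <= eps * enorm (d - c).
    apply: le_trans (_ : T * (enorm (v T) * enorm (d - c)) <= _).
      by rewrite ler_wpM2l ?(ltW T0)// dotp_le_enorm.
    by rewrite mulrA ler_wpM2r ?enorm_ge0// ltW.
  have l'T : dotp (x T - c) (d - c) <= eps * enorm (d - c).
    apply: le_trans (dotp_le_enorm _ _) _.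
    by rewrite ler_wpM2r ?enorm_ge0// ltW.
  have p1 : 0 <= T ^+ 2 * energy F x v T by rewrite mulr_ge0 ?sqr_ge0 ?energy_ge0.
  have p2 : 0 <= (2 * lam ^+ 2 + 2 * lam) * half_sqdist x c T.
    apply: mulr_ge0; last by rewrite divr_ge0 ?dotp_ge0.
    by have := sqr_ge0 lam; have := lam_gt0; lra.
  have p3 : 0 <= C / lam * T `^ (- (2 * lam)).
    by rewrite mulr_ge0 ?powR_ge0// divr_ge0// ltW.
  have ee : lam * (eps * eps) <= lam * eps.
    by rewrite ler_pM2l// ler_piMr// ltW.
  have := W_le t T t1t tT; rewrite {1}/W.
  have := ler_wpM2l (ltW lam_gt0) lT; have := ler_wpM2l (ltW lam_gt0) rT.
  have : lam * (2 * lam) * dotp (x T - c) (d - c) <= lam * (2 * lam) * (eps * enorm (d - c)).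
    by rewrite ler_wpM2l// mulr_ge0 ?mulr_ge0// ltW.
  rewrite /k in epsk; move: p1 p2 p3 epsk Wt ee; lra.
have t0 := lt_le_trans t1_gt0 t1t.
have Sle : t ^+ 2 * energy F x v t + lam * (t * radial x v c t) <= C * t `^ (- (2 * lam)).
  have := potential_le t1t; rewrite /potential powRN ler_pdivlMr ?powR_gt0//.
  by rewrite mulrC.
rewrite -(ler_pM2l lam_gt0).
rewrite [leRHS](_ : _ = (2 * lam ^+ 2 + 2 * lam) * half_sqdist x c t
  + C / lam * t `^ (- (2 * lam)) + C * t `^ (- (2 * lam))); last first.
  by field; rewrite gt_eqF.
by move: W_ge0; rewrite /W; lra.
Qed.

End TangentialDrift.

(** * The rate of convergence *)

(** If [x - c] is almost orthogonal to the directions of [A] at [c], then [c] is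
    almost a nearest point: expand [|x - c|^2] as
    [<x - c, x - y> + <x - c, y - c>]. *)
Lemma enorm_le_edist (R : realType) n (A : set 'rV[R]_n) (x c : 'rV[R]_n) (M : R) :
  A !=set0 -> 0 <= M ->
  (forall y, A y -> dotp (x - c) (y - c) <= enorm (y - c) * (M + enorm (x - c) / 4)) ->
  enorm (x - c) / 2 <= Defs.edist x A + 2 * M.
Proof.
move=> [a Aa] M0 HM; rewrite -lerBlDr; apply: lb_le_inf; first by exists (enorm (x - a)), a.
move=> _ [y Ay <-]; rewrite lerBlDr.
have u0 := enorm_ge0 (x - c).
have [far|near_] := ltP (enorm (x - c)) (enorm (x - y)); first by lra.
have [u0'|u0'] := eqVneq (enorm (x - c)) 0.
  by have := enorm_ge0 (x - y); lra.
have up : 0 < enorm (x - c) by rewrite lt_neqAle eq_sym u0' u0.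
have yc : enorm (y - c) <= 2 * enorm (x - c).
  apply: le_trans (enorm_triangle x _ _) _; rewrite (enorm_distC y); lra.
have sq : enorm (x - c) ^+ 2 = dotp (x - c) (x - y) + dotp (x - c) (y - c).
  by rewrite enorm_sqr -dotpDr subrKA.
have h1 := dotp_le_enorm (x - c) (x - y).
have h2 := HM y Ay.
have h3 : enorm (y - c) * (M + enorm (x - c) / 4) <=
    2 * enorm (x - c) * (M + enorm (x - c) / 4).
  by rewrite ler_wpM2r// addr_ge0// divr_ge0.
rewrite -(ler_pM2l up); lra.
Qed.

Lemma powR_dominates (R : realType) (r K C D A : R) :
  2 < r -> 0 < K -> 0 <= C -> 0 <= D ->
  exists N, [/\ 1 <= N, A <= N & C + D * N ^+ 2 < K * (N / 4) `^ r].
Proof.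
move=> r2 K0 C0 D0; have p0 : 0 < r - 2 by rewrite subr_gt0.
pose Q := (C + 16 * D + 1) / K.
have Q0 : 0 <= Q by rewrite divr_ge0 ?(ltW K0)// !addr_ge0// mulr_ge0.
pose M := Num.max (Num.max A 1) (Q `^ (r - 2)^-1).
have M1 : 1 <= M by rewrite !le_max lexx orbT.
have MA : A <= M by rewrite !le_max lexx.
have M0 : 0 < M by exact: lt_le_trans M1.
have MQ : Q <= M `^ (r - 2).
  have -> : Q = (Q `^ (r - 2)^-1) `^ (r - 2).
    by rewrite -powRrM mulVf ?powRr1// gt_eqF.
  apply: ge0_ler_powR; rewrite ?nnegrE ?powR_ge0 ?(ltW p0) ?(ltW M0)//.
  by rewrite le_max lexx orbT.
exists (4 * M); split.
- by lra.
- by lra.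
- rewrite [4 * M / 4](_ : _ = M); last by field.
  have -> : M `^ r = M ^+ 2 * M `^ (r - 2).
    rewrite -powR_mulrn ?(ltW M0)// -powRD; last by rewrite (gt_eqF M0) implybT.
    by congr powR; rewrite addrC subrK.
  have KQ : C + 16 * D + 1 <= K * M `^ (r - 2).
    by rewrite [leRHS]mulrC -ler_pdivrMr//; exact: MQ.
  have M2 : 1 <= M ^+ 2 by rewrite exprn_ege1.
  have h := ler_wpM2l (le_trans ler01 M2) KQ.
  have : C * 1 <= C * M ^+ 2 by rewrite ler_wpM2l.
  by lra.
Qed.

Section Rate.
Context {R : realType} {n : nat} (F : 'rV[R]_n -> R) (x v : R -> 'rV[R]_n).
Variables (lam t1 C kap : R) (c : 'rV[R]_n).
Hypothesis F_convex : convex_function setT F.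
Hypothesis F_differentiable : forall y, differentiable F y.
Hypothesis lam_gt0 : 0 < lam.
Hypothesis flow : damped_flow F (2 * lam + 1) t1 x v.
Hypothesis c_argmin : argmin F c.
Hypothesis energy_small : forall eps, 0 < eps ->
  \forall t \near +oo, t ^+ 2 * energy F x v t < eps.
Hypothesis x_cvg : forall eps, 0 < eps ->
  \forall t \near +oo, enorm (x t - c) < eps.
Hypothesis potential_le : forall t, t1 <= t -> potential F x v lam c t <= C.
Hypothesis C_ge0 : 0 <= C.
Hypothesis t1_ge1 : 1 <= t1.
Hypothesis kap_gt0 : 0 < kap.
Hypothesis kap_le : kap <= lam.

Let argmin_nonempty : argmin F !=set0. Proof. by exists c. Qed.

Let C1 := C * (lam^-1 + (lam ^+ 2)^-1).

Let C1_ge0 : 0 <= C1.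
Proof. by rewrite mulr_ge0// addr_ge0 ?invr_ge0 ?sqr_ge0// ltW. Qed.

(** Integration of [tangential_drift] with the integrating factor
    [t^(2 lam - 1)]. *)
Lemma tangential_displacement d B t2 T : argmin F d -> 0 <= B ->
  t1 <= t2 -> t2 <= T ->
  (forall s, t2 <= s <= T -> half_sqdist x c s <= B * s `^ (- kap)) ->
  dotp (x T - c) (d - c) <=
    T `^ (- kap) * (2 * (lam + 1) / lam * B + C1 / lam)
    + T `^ (- kap) * t2 `^ (2 * lam) * enorm (x t2 - c) * enorm (d - c).
Proof.
move=> Fd B0 t12 t2T Hq.
pose k := 2 * (lam + 1) / lam * B.
have k0 : 0 <= k by rewrite mulr_ge0// divr_ge0 ?mulr_ge0 ?addr_ge0// ltW.
pose G s := s `^ (2 * lam) * dotp (x s - c) (d - c)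
  - k * s `^ (2 * lam - kap) - C1 / lam * s `^ lam.
have GT : G T <= G t2.
  apply: ler_of_derive_le0 => // s /[dup] st /andP[ts _].
  have t1s := le_trans t12 ts; have s1 := le_trans t1_ge1 t1s.
  have s0 : 0 < s := lt_le_trans ltr01 s1.
  have dl := derive_dotp_fun (curve_derive_subl c (flow_velocity flow t1s))
    (curve_derive_cst s (d - c)).
  eexists; first by rewrite /G; repeat derive_step.
  rewrite dotp0r.
  have drift := tangential_drift F_convex F_differentiable lam_gt0 flow c_argmin
    energy_small x_cvg potential_le C_ge0 Fd t1s.
  have P0 : 0 < s `^ (2 * lam) by rewrite powR_gt0.
  have Pk : s `^ (2 * lam - kap) = s `^ (2 * lam) * s `^ (- kap).
    by rewrite -powRD// (gt_eqF s0) implybT.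
  have h1 : 2 * (lam + 1) * half_sqdist x c s <= lam * (k * s `^ (- kap)).
    rewrite (_ : lam * _ = 2 * (lam + 1) * (B * s `^ (- kap))); last first.
      by rewrite /k; field; rewrite gt_eqF.
    by rewrite ler_wpM2l ?Hq// mulr_ge0// addr_ge0// ltW.
  have h2 : lam * (k * s `^ (- kap)) <= (2 * lam - kap) * (k * s `^ (- kap)).
    apply: ler_wpM2r; first by rewrite mulr_ge0// powR_ge0.
    by have := kap_le; lra.
  have h3 : C1 * (s `^ (2 * lam) * s `^ (- (2 * lam))) <= C1 * s `^ lam.
    rewrite powRN divff ?gt_eqF// ler_wpM2l//.
    by rewrite -(powRr0 s) ler_powR// ltW.
  have h4 := ler_wpM2l (ltW P0) drift.
  have h5 := ler_wpM2l (ltW P0) (le_trans h1 h2).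
  rewrite [leLHS](_ : _ = (s `^ (2 * lam) * (s * dotp (v s) (d - c)
      + 2 * lam * dotp (x s - c) (d - c))
    - s `^ (2 * lam) * ((2 * lam - kap) * (k * s `^ (- kap)))
    - C1 * s `^ lam) / s); last first.
    by rewrite Pk; field; rewrite !gt_eqF.
  rewrite pmulr_lle0 ?invr_gt0//.
  move: h4 h5 h3; rewrite -/C1; lra.
have t20 : 0 < t2 by rewrite (lt_le_trans ltr01)// (le_trans t1_ge1).
have T1 : 1 <= T by rewrite (le_trans t1_ge1)// (le_trans t12).
have T0 : 0 < T := lt_le_trans ltr01 T1.
have PT : 0 < T `^ (2 * lam) by rewrite powR_gt0.
have h1 : T `^ (2 * lam - kap) = T `^ (2 * lam) * T `^ (- kap).
  by rewrite -powRD// (gt_eqF T0) implybT.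
have h2 : T `^ lam <= T `^ (2 * lam) * T `^ (- kap).
  by rewrite -h1 ler_powR//; have := kap_le; lra.
have h3 : 1 <= T `^ (2 * lam) * T `^ (- kap).
  by rewrite -h1 -[leLHS](powRr0 T) ler_powR//; have := kap_le; have := lam_gt0; lra.
have h4 : t2 `^ (2 * lam) * dotp (x t2 - c) (d - c) <=
    t2 `^ (2 * lam) * (enorm (x t2 - c) * enorm (d - c)).
  by rewrite ler_wpM2l ?powR_ge0// dotp_le_enorm.
have h5 : 0 <= k * t2 `^ (2 * lam - kap) by rewrite mulr_ge0// powR_ge0.
have Cl : 0 <= C1 / lam by rewrite divr_ge0// ltW.
have h6 : 0 <= C1 / lam * t2 `^ lam by rewrite mulr_ge0// powR_ge0.
have h7 := ler_wpM2l Cl h2.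
have h8 : t2 `^ (2 * lam) * (enorm (x t2 - c) * enorm (d - c)) * 1 <=
   t2 `^ (2 * lam) * (enorm (x t2 - c) * enorm (d - c)) * (T `^ (2 * lam) * T `^ (- kap)).
  by rewrite ler_wpM2l ?mulr_ge0 ?powR_ge0 ?enorm_ge0.
rewrite -(ler_pM2l PT) -/k.
move: GT; rewrite /G h1; lra.
Qed.

Variables (gamma2 K : R).
Hypothesis gamma2_gt2 : 2 < gamma2.
Hypothesis kapE : kap = 2 / (gamma2 - 2).
Hypothesis K_gt0 : 0 < K.
Hypothesis growth : forall t, t1 <= t ->
  K * Defs.edist (x t) (argmin F) `^ gamma2 <= gap F x t.

(** A bootstrap.  While [|x - c| <= N t^(- kap)], the half squared distance is at
    most [eps N t^(- kap) / 2], since [|x - c| <= eps] eventually; hence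
    [tangential_displacement] and [dotp_bound_near_vertex] give
    [|x - c| <= 2 d(x, argmin F) + N t^(- kap) / 2].  If equality were reached at
    some first [T], the distance would be at least [N T^(- kap) / 4] there, so
    growth would make [T^2 (F(x) - inf F)] large, and the bound on the potential
    would give [t^(2 kap) |x - c|^2] a negative slope at a time where it is
    largest so far. *)
Lemma distance_rate : exists N, \forall t \near +oo,
  dotp (x t - c) (x t - c) <= N * t `^ (- (2 * kap)).
Proof.
have [L L0 HL] := dotp_bound_near_vertex (argmin F) c.
(* makes [L 2 (lam + 1) / lam (eps N / 2)] equal to [N / 16] *)
pose eps := lam / (16 * L * (lam + 1)).
have eps0 : 0 < eps.
  by rewrite divr_gt0 ?mulr_gt0 ?addr_gt0.
have [T1 [_ HT1]] := x_cvg eps0.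
pose t2 := Num.max t1 (T1 + 1).
have t12 : t1 <= t2 by rewrite le_max lexx.
have t2_ge1 : 1 <= t2 := le_trans t1_ge1 t12.
have t2_gt0 : 0 < t2 := lt_le_trans ltr01 t2_ge1.
have u_le t : t2 <= t -> enorm (x t - c) <= eps.
  move=> t2t; apply/ltW/HT1; apply: lt_le_trans t2t.
  by rewrite lt_max ltrDl ltr01 orbT.
pose M0 := L * (C1 / lam) + t2 `^ (2 * lam) * eps.
pose z t := t `^ (2 * kap) * (2 * half_sqdist x c t).
have [N [N1 NA Nbig]] := powR_dominates (Num.max (16 * M0) (z t2 + 1)) gamma2_gt2 K_gt0
  C_ge0 (mulr_ge0 (ltW lam_gt0) (ltW kap_gt0)).
have N0 : 0 < N := lt_le_trans ltr01 N1.
have NM0 : 16 * M0 <= N by apply: le_trans NA; rewrite le_max lexx.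
have Nz : z t2 < N ^+ 2.
  have : z t2 + 1 <= N by apply: le_trans NA; rewrite le_max lexx orbT.
  by have := sqr_ge0 (N - 1); nra.
have u2 t : dotp (x t - c) (x t - c) = 2 * half_sqdist x c t.
  by rewrite /half_sqdist; field.
have dz t : t1 <= t -> is_derive t 1 z
    (2 * t `^ (2 * kap) / t * (kap * (2 * half_sqdist x c t) + t * radial x v c t)).
  move=> t1t; have t0 : 0 < t := lt_le_trans (flow_start_gt0 flow) t1t.
  have dq := derive_half_sqdist flow c t1t.
  rewrite /z; eapply is_derive_eq; first by repeat derive_step.
  by field; rewrite gt_eqF.
have powN2 t : 0 < t -> t `^ (- (2 * kap)) = (t `^ (- kap)) ^+ 2.
  by move=> t0; rewrite -powR_mulrn ?powR_ge0// -powRrM; congr powR; ring.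
have zb : forall t, t2 <= t -> z t < N ^+ 2.
  apply: continuous_bootstrap => //.
    by move=> s ts; exact: (continuous_of_derive (dz s (le_trans t12 ts))).
  move=> T t2T Hz.
  have uN s : t2 <= s <= T -> enorm (x s - c) <= N * s `^ (- kap).
    move=> /[dup] sT /andP[ts _]; have s0 : 0 < s := lt_le_trans t2_gt0 ts.
    rewrite ler_enorm ?mulr_ge0 ?powR_ge0 ?(ltW N0)// exprMn -powN2// u2 powRN.
    by rewrite ler_pdivlMr ?powR_gt0// mulrC; exact: Hz.
  have t1T := le_trans t12 t2T; have T0 : 0 < T := lt_le_trans t2_gt0 t2T.
  have T1' : 1 <= T := le_trans t2_ge1 t2T.
  set p := T `^ (- kap); have p0 : 0 < p by rewrite powR_gt0.
  have close : enorm (x T - c) / 2 <= Defs.edist (x T) (argmin F) + N * p / 4.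
    have Hu d : argmin F d -> dotp (x T - c) (d - c) <=
        p * (2 * (lam + 1) / lam * (eps * N / 2) + C1 / lam)
        + p * t2 `^ (2 * lam) * eps * enorm (d - c).
      move=> Fd; apply: le_trans (tangential_displacement (B := eps * N / 2) Fd _ t12 t2T _) _.
      - by rewrite divr_ge0// mulr_ge0 ?(ltW eps0) ?(ltW N0).
      - move=> s /[dup] sT /andP[ts _].
        have := ler_pM (enorm_ge0 _) (enorm_ge0 _) (u_le s ts) (uN s sT).
        by rewrite /half_sqdist -enorm_sqr expr2; lra.
      - rewrite lerD2l ler_wpM2r ?enorm_ge0// ler_wpM2l ?u_le//.
        by rewrite mulr_ge0 ?powR_ge0.
    have a0 : 0 <= p * (2 * (lam + 1) / lam * (eps * N / 2) + C1 / lam).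
      have e1 : 0 <= 2 * (lam + 1) / lam by rewrite divr_ge0 ?mulr_ge0 ?addr_ge0// ltW.
      have e2 : 0 <= eps * N / 2 by rewrite divr_ge0// mulr_ge0 ?(ltW eps0) ?(ltW N0).
      have e3 : 0 <= C1 / lam by rewrite divr_ge0// ltW.
      by rewrite mulr_ge0 ?(ltW p0)// addr_ge0// mulr_ge0.
    have HV := HL _ _ _ a0 Hu.
    have ME : L * (p * (2 * (lam + 1) / lam * (eps * N / 2) + C1 / lam))
        + p * t2 `^ (2 * lam) * eps = p * (N / 16 + M0).
      by rewrite /M0 /eps; field; rewrite !gt_eqF ?addr_gt0.
    have Mp : p * (N / 16 + M0) <= p * (N / 8) by rewrite ler_pM2l//; lra.
    have := @enorm_le_edist _ _ (argmin F) (x T) c (p * (N / 8)) argmin_nonempty _ _.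
    move=> /(_ _ _)H; apply: le_trans (H _ _) _; last by lra.
      by rewrite mulr_ge0 ?(ltW p0)// divr_ge0// ltW.
    move=> y Fy; apply: le_trans (HV y Fy) _.
    by rewrite ME ler_wpM2l ?enorm_ge0// lerD2r.
  rewrite lt_neqAle Hz ?t2T ?lexx// andbT; apply/eqP => zT.
  have t2T' : t2 < T.
    by rewrite lt_neqAle t2T andbT; apply/eqP => t2E; move: Nz; rewrite t2E zT ltxx.
  have dz0 := derive_ge0_of_max t2T' (dz T t1T) _.
  have {}dz0 : 0 <= kap * (2 * half_sqdist x c T) + T * radial x v c T.
    rewrite -(@pmulr_rge0 _ (2 * T `^ (2 * kap) / T)).
      by apply: dz0 => s /Hz; rewrite zT.
    by rewrite divr_gt0// mulr_gt0// powR_gt0.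
  have qT : 2 * half_sqdist x c T = (N * p) ^+ 2.
    rewrite exprMn -powN2// powRN -zT /z; field.
    by rewrite gt_eqF ?powR_gt0.
  have uT : enorm (x T - c) = N * p.
    apply/eqP; rewrite -(@eqrXn2 _ 2) ?enorm_ge0 ?mulr_ge0 ?(ltW N0) ?(ltW p0)//.
    by rewrite enorm_sqr u2 qT.
  have dist : N / 4 * p <= Defs.edist (x T) (argmin F) by move: close; rewrite uT; lra.
  have gapT : K * (N / 4) `^ gamma2 * (p ^+ 2 / T ^+ 2) <= gap F x T.
    apply: le_trans (growth t1T); rewrite -mulrA ler_pM2l//.
    have -> : p ^+ 2 / T ^+ 2 = p `^ gamma2.
      rewrite -powN2// /p -powRrM -powR_mulrn ?(ltW T0)// -powRB; last first.
        by rewrite (gt_eqF T0) implybT.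
      congr powR; rewrite kapE; field.
      by rewrite gt_eqF// subr_gt0.
    rewrite -powRM ?divr_ge0 ?(ltW N0) ?(ltW p0)//.
    apply: ge0_ler_powR => //; rewrite ?nnegrE.
    - by have := gamma2_gt2; lra.
    - by rewrite mulr_ge0 ?divr_ge0 ?(ltW N0) ?(ltW p0).
    - apply: le_trans dist; by rewrite mulr_ge0 ?divr_ge0 ?(ltW N0) ?(ltW p0).
  have rad := radial_le_of_potential T0 (potential_le t1T).
  have Tp : T `^ (- (2 * lam)) <= p ^+ 2.
    by rewrite -powN2// ler_powR//; have := kap_le; lra.
  have gE := gap_le_energy F x v T.
  have rad' : lam * (T * radial x v c T) <= C * p ^+ 2 - T ^+ 2 * gap F x T.
    have h := ler_wpM2l (ltW T0) rad.
    have e1 : T * (C * (T `^ (- (2 * lam)) / T) - T * energy F x v T) =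
       C * T `^ (- (2 * lam)) - T ^+ 2 * energy F x v T by field; rewrite gt_eqF.
    have h2 : T ^+ 2 * gap F x T <= T ^+ 2 * energy F x v T by rewrite ler_wpM2l ?sqr_ge0.
    have h3 := ler_wpM2l C_ge0 Tp.
    by move: h; rewrite e1; lra.
  have g2 : K * (N / 4) `^ gamma2 * p ^+ 2 <= T ^+ 2 * gap F x T.
    have := ler_wpM2l (sqr_ge0 T) gapT; apply: le_trans.
    by rewrite le_eqVlt; apply/orP; left; apply/eqP; field; rewrite gt_eqF.
  have dz1 := ler_wpM2l (ltW lam_gt0) dz0; rewrite mulr0 qT in dz1.
  have : p ^+ 2 * (C + lam * kap * N ^+ 2) < p ^+ 2 * (K * (N / 4) `^ gamma2).
    by rewrite ltr_pM2l ?exprn_gt0.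
  by lra.
exists (N ^+ 2); exists t2; split; first exact: num_real.
move=> t /ltW t2t; have t0 : 0 < t := lt_le_trans t2_gt0 t2t.
rewrite u2 powRN ler_pdivlMr ?powR_gt0// mulrC; exact/ltW/zb.
Qed.

(** Completing the square in the potential:
    [t^2 (F(x) - inf F) <= C t^(- 2 lam) + lam^2 |x - c|^2 / 2]. *)
Lemma gap_rate : exists M, \forall t \near +oo,
  gap F x t <= M * t `^ (- (2 * kap + 2)).
Proof.
have [N [T [_ HT]]] := distance_rate.
exists (C + lam ^+ 2 / 2 * N); exists (Num.max t1 T); split; first exact: num_real.
move=> t; rewrite gt_max => /andP[/ltW t1t Tt]; have t_ge1 := le_trans t1_ge1 t1t.
have t0 : 0 < t := lt_le_trans ltr01 t_ge1.
have u := HT t Tt; have rad := radial_le_of_potential t0 (potential_le t1t).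
have {}rad := ler_wpM2l (ltW t0) rad.
have Tp : t `^ (- (2 * lam)) <= t `^ (- (2 * kap)).
  by rewrite ler_powR//; have := kap_le; lra.
have h3 := ler_wpM2l C_ge0 Tp.
have e1 : t * (C * (t `^ (- (2 * lam)) / t) - t * energy F x v t) =
   C * t `^ (- (2 * lam)) - t ^+ 2 * energy F x v t by field; rewrite gt_eqF.
have -> : t `^ (- (2 * kap + 2)) = t `^ (- (2 * kap)) / t ^+ 2.
  rewrite opprD powRD; last by rewrite (gt_eqF t0) implybT.
  by rewrite [t `^ (- 2)]powRN powR_mulrn// ltW.
rewrite mulrA ler_pdivlMr ?exprn_gt0//.
have cs : - (t * enorm (v t)) * (lam * enorm (x t - c)) <= lam * (t * radial x v c t).
  rewrite mulNr lerNl -mulrN -mulrN mulrACA [leRHS](_ : _ =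
    lam * (t * (enorm (v t) * enorm (x t - c)))); last by ring.
  rewrite ler_wpM2l ?(ltW lam_gt0)// ler_wpM2l ?(ltW t0)// mulrC.
  by apply: le_trans (normr_dotp_le _ _); rewrite -normrN ler_norm.
have := sqr_ge0 (t * enorm (v t) - lam * enorm (x t - c)).
have h4 : lam ^+ 2 / 2 * dotp (x t - c) (x t - c) <=
    lam ^+ 2 / 2 * (N * t `^ (- (2 * kap))).
  by rewrite ler_wpM2l// divr_ge0// sqr_ge0.
move: rad; rewrite e1 /energy -!enorm_sqr in h4 *; lra.
Qed.

End Rate.

Lemma H1W (R : realType) n (F : 'rV[R]_n -> R) (g g' : R) :
  0 < g -> g <= g' -> H1 F g' -> H1 F g.
Proof.
move=> g0 gg' h1 c Fc; have g'0 := lt_le_trans g0 gg'.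
have [eta eta0 Heta] := H1_work g'0 h1 Fc; exists eta => // y yc.
rewrite mul1r mulrC ler_pdivlMr// mulrC; apply: le_trans (Heta y yc).
by rewrite ler_wpM2r// (infval_argmin Fc) subr_ge0; exact: Fc.
Qed.

Theorem theorem4p5 (R : realType) (n : nat) (F : 'rV[R]_n -> R)
  (gamma1 gamma2 alpha t0 : R) (x : R -> 'rV[R]_n)
  (F_convex : convex_function setT F)
  (F_differentiable : forall y, differentiable F y)
  (argmin_nonempty : argmin F !=set0)
  (gamma1_gt2 : 2 < gamma1)
  (gamma2_gt2 : 2 < gamma2)
  (alpha_gt0 : 0 < alpha)
  (t0_gt0 : 0 < t0)
  (ode_well_posed : well_posed F alpha t0)
  (x_solution : solves_ode F alpha t0 x)
  (F_coercive : coercive F)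
  (F_H1 : H1 F gamma1)
  (F_H2 : H2 F gamma2)
  (gamma1_le_gamma2 : gamma1 <= gamma2)
  (alpha_ge : (gamma1 + 2) / (gamma1 - 2) <= alpha) :
  (fun t => F (x t) - infval F)
    =O_+oo (fun t => 1 / t `^ (2 * gamma2 / (gamma2 - 2))).
Proof.
pose lam := (alpha - 1) / 2; pose kap := 2 / (gamma2 - 2).
have g1 : 0 < gamma1 - 2 by rewrite subr_gt0.
have g2 : 0 < gamma2 - 2 by rewrite subr_gt0.
have lamg : 2 <= lam * (gamma1 - 2).
  by move: alpha_ge; rewrite ler_pdivrMr// /lam; lra.
have lam0 : 0 < lam by rewrite -(pmulr_lgt0 _ g1); lra.
have kap0 : 0 < kap by rewrite divr_gt0.
have kap_le : kap <= lam.
  rewrite ler_pdivrMr//; apply: le_trans lamg _.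
  by rewrite ler_wpM2l ?(ltW lam0)// lerD2r.
have gamma_gt0 : 0 < 2 * (lam + 1) / lam by rewrite divr_gt0// mulr_gt0// addr_gt0.
have h1 : H1 F (2 * (lam + 1) / lam).
  by apply: (H1W gamma_gt0 _ F_H1); rewrite ler_pdivrMr//; lra.
have alphaE : alpha = 2 * lam + 1 by rewrite /lam; field.
have [v flow] : exists v, damped_flow F (2 * lam + 1) (t0 + 1) x v.
  rewrite -alphaE; apply: (damped_flow_of_solves_ode F_differentiable t0_gt0) => //.
  by rewrite ltrDl.
have esmall := sqr_time_energy_vanishes_of_H1 F_convex F_differentiable
  argmin_nonempty F_coercive lam0 h1 flow.
have [c Fc xc] := flow_converges argmin_nonempty lam0 flow F_convex
  F_differentiable F_coercive h1.
have [eta eta0 Heta] := H1_work gamma_gt0 h1 Fc.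
have [K [eps [K0 eps0 HK]]] := F_H2 c Fc.
have m0 : 0 < Num.min eta eps by rewrite lt_min eta0.
have [T [_ HT]] := xc _ m0.
pose t1 := Num.max (t0 + 1) (T + 1).
have t01 : t0 + 1 <= t1 by rewrite le_max lexx.
have t11 : 1 <= t1 by apply: le_trans t01; rewrite lerDr ltW.
have near_c t : t1 <= t -> enorm (x t - c) < eta /\ enorm (x t - c) < eps.
  move=> t1t; apply/andP; rewrite -lt_min; apply: HT; apply: lt_le_trans t1t.
  by rewrite lt_max ltrDl ltr01 orbT.
have flow1 := damped_flowW t01 flow.
have pot t : t1 <= t -> potential F x v lam c t <= `|potential F x v lam c t1|.
  move=> t1t; apply: le_trans (ler_norm _).
  apply: (potential_nonincreasing lam0 flow1) => // s /andP[t1s _].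
  by apply: Heta; case: (near_c s t1s).
have [M [T' [_ HM]]] := gap_rate F_convex F_differentiable lam0 flow1 Fc esmall xc
  pot (normr_ge0 _) t11 kap0 kap_le gamma2_gt2 erefl K0
  (fun t t1t => HK (x t) (near_c t t1t).2).
apply/eqO_exP; exists (`|M| + 1); first by rewrite ltr_pwDr.
exists (Num.max T' 1); split; first exact: num_real.
move=> t; rewrite gt_max => /andP[T't t_gt1].
have -> : 1 / t `^ (2 * gamma2 / (gamma2 - 2)) = t `^ (- (2 * kap + 2)).
  rewrite powRN div1r; congr (_ `^ _)^-1; rewrite /kap; field.
  by rewrite gt_eqF.
rewrite ger0_norm; last exact: (gap_ge0 x argmin_nonempty t).
rewrite (ger0_norm (powR_ge0 _ _)); apply: le_trans (HM t T't) _.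
by rewrite ler_wpM2r ?powR_ge0//; have := ler_norm M; lra.
Qed.
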